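(* The following statement is provable in $\mathsf{RCA}_0$: for every partial order $\mathbf{P}$, $\mathbf{P}$ is an interval order if and only if $\mathbf{P}$ does not contain $\mathbf{2}\oplus\mathbf{2}$.
   Context: $\mathsf{RCA}_0$ is the base subsystem of second-order arithmetic (comprehension restricted to $\Delta^0_1$ formulas, induction for $\Sigma^0_1$ formulas). A partial order $\mathbf{P}=(P,\leq_P)$ consists of a set $P\subseteq\mathbb{N}$ and a reflexive, transitive, antisymmetric relation $\leq_P\subseteq P\times P$; it is a linear order if moreover any two elements are comparable; $p<_P q$ means $p\leq_P q$ and $p\neq q$. $\mathbf{P}$ is an interval order if there exist a linear order $\mathbf{L}=(L,\leq_L)$ and a set $F\subseteq P\times L$ such that, writing $F(p)=\{x\in L:(p,x)\in F\}$: (i1) for every $p\in P$, $F(p)\neq\emptyset$ and for all $x,y\in F(p)$ and $z\in L$, $x<_L z<_L y$ implies $z\in F(p)$; (i2) for all $p,q\in P$, $p<_P q$ iff $x<_L y$ for all $x\in F(p)$, $y\in F(q)$. $\mathbf{P}$ does not contain $\mathbf{2}\oplus\mathbf{2}$ if for all $p_0,q_0,p_1,q_1\in P$, $p_0<_P q_0$ and $p_1<_P q_1$ imply $p_0\leq_P q_1$ or $p_1\leq_P q_0$. *)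

(* Defs.v *)
From Stdlib Require Import List.
Import ListNotations.

(** * The language of second-order arithmetic

    Two-sorted, in de Bruijn style: number variables and set variables are
    indexed separately, so a number quantifier shifts only number indices and a
    set quantifier shifts only set indices.  Equality is primitive for numbers
    only. *)

Inductive term : Type :=
| tvar (n : nat)
| tzero
| tone
| tadd (s t : term)
| tmul (s t : term).

Inductive form : Type :=
| fBot
| fEq (s t : term)
| fLt (s t : term)
| fIn (t : term) (X : nat)
| fImp (f g : form)
| fAnd (f g : form)
| fOr (f g : form)
| fAllN (f : form)
| fExN (f : form)
| fAllS (f : form)
| fExS (f : form).

Definition fNot (f : form) : form := fImp f fBot.
Definition fIff (f g : form) : form := fAnd (fImp f g) (fImp g f).

Declare Scope form_scope.
Delimit Scope form_scope with form.
Bind Scope form_scope with form.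
Notation "s ≐ t" := (fEq s t) (at level 70, no associativity) : form_scope.
Notation "s ≺ t" := (fLt s t) (at level 70, no associativity) : form_scope.
Notation "t ∈ X" := (fIn t X) (at level 70, no associativity) : form_scope.
Notation "~ f" := (fNot f) : form_scope.
Notation "f /\ g" := (fAnd f g) : form_scope.
Notation "f \/ g" := (fOr f g) : form_scope.
Notation "f ⇒ g" := (fImp f g) (at level 90, right associativity) : form_scope.
Notation "f <-> g" := (fIff f g) : form_scope.
Local Open Scope form_scope.

(** ** Substitution: terms for number variables, set variables for set
    variables. *)

Definition scons {A : Type} (a : A) (s : nat -> A) (n : nat) : A :=
  match n with 0 => a | S m => s m end.

Fixpoint subst_term (s : nat -> term) (t : term) : term :=
  match t with
  | tvar n => s n
  | tzero => tzero
  | tone => tone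
  | tadd t1 t2 => tadd (subst_term s t1) (subst_term s t2)
  | tmul t1 t2 => tmul (subst_term s t1) (subst_term s t2)
  end.

Definition shift_term (t : term) : term := subst_term (fun n => tvar (S n)) t.

Definition up_num (s : nat -> term) : nat -> term :=
  scons (tvar 0) (fun n => shift_term (s n)).
Definition up_set (r : nat -> nat) : nat -> nat := scons 0 (fun n => S (r n)).

Fixpoint subst (s : nat -> term) (r : nat -> nat) (f : form) : form :=
  match f with
  | fBot => fBot
  | fEq t u => fEq (subst_term s t) (subst_term s u)
  | fLt t u => fLt (subst_term s t) (subst_term s u)
  | fIn t X => fIn (subst_term s t) (r X)
  | fImp f g => fImp (subst s r f) (subst s r g)
  | fAnd f g => fAnd (subst s r f) (subst s r g)
  | fOr f g => fOr (subst s r f) (subst s r g)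
  | fAllN f => fAllN (subst (up_num s) r f)
  | fExN f => fExN (subst (up_num s) r f)
  | fAllS f => fAllS (subst s (up_set r) f)
  | fExS f => fExS (subst s (up_set r) f)
  end.

Definition shift_num (f : form) : form :=
  subst (fun n => tvar (S n)) (fun X => X) f.
Definition shift_set (f : form) : form := subst tvar S f.
Definition inst_num (t : term) (f : form) : form :=
  subst (scons t tvar) (fun X => X) f.
Definition inst_set (X : nat) (f : form) : form :=
  subst tvar (scons X (fun Y => Y)) f.

(** * Classical two-sorted natural deduction with equality

    The axioms [T] may be open formulas.  They stand for their universal
    closures: [prv_ax] makes them available under every context, whose formulas
    [prv_allN_i] and [prv_allS_i] require not to mention the generalized
    variable. *)

Inductive prv (T : form -> Prop) : list form -> form -> Prop :=
| prv_ax G f : T f -> prv T G f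
| prv_hyp G f : In f G -> prv T G f
| prv_raa G f : prv T (fNot f :: G) fBot -> prv T G f
| prv_imp_i G f g : prv T (f :: G) g -> prv T G (f ⇒ g)
| prv_imp_e G f g : prv T G (f ⇒ g) -> prv T G f -> prv T G g
| prv_and_i G f g : prv T G f -> prv T G g -> prv T G (f /\ g)
| prv_and_e1 G f g : prv T G (f /\ g) -> prv T G f
| prv_and_e2 G f g : prv T G (f /\ g) -> prv T G g
| prv_or_i1 G f g : prv T G f -> prv T G (f \/ g)
| prv_or_i2 G f g : prv T G g -> prv T G (f \/ g)
| prv_or_e G f g h :
    prv T G (f \/ g) -> prv T (f :: G) h -> prv T (g :: G) h -> prv T G h
| prv_allN_i G f : prv T (map shift_num G) f -> prv T G (fAllN f)
| prv_allN_e G f t : prv T G (fAllN f) -> prv T G (inst_num t f)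
| prv_exN_i G f t : prv T G (inst_num t f) -> prv T G (fExN f)
| prv_exN_e G f g :
    prv T G (fExN f) -> prv T (f :: map shift_num G) (shift_num g) -> prv T G g
| prv_allS_i G f : prv T (map shift_set G) f -> prv T G (fAllS f)
| prv_allS_e G f X : prv T G (fAllS f) -> prv T G (inst_set X f)
| prv_exS_i G f X : prv T G (inst_set X f) -> prv T G (fExS f)
| prv_exS_e G f g :
    prv T G (fExS f) -> prv T (f :: map shift_set G) (shift_set g) -> prv T G g
| prv_eq_refl G t : prv T G (t ≐ t)
| prv_eq_subst G f t u :
    prv T G (t ≐ u) -> prv T G (inst_num t f) -> prv T G (inst_num u f).

Definition provable (T : form -> Prop) (f : form) : Prop := prv T [] f.

(** * The system RCA0 *)

Notation v0 := (tvar 0).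
Notation v1 := (tvar 1).
Notation v2 := (tvar 2).

(** [shift_term] ensures that the bound of a bounded quantifier does not mention
    the quantified variable. *)
Inductive delta00 : form -> Prop :=
| d_bot : delta00 fBot
| d_eq t u : delta00 (t ≐ u)
| d_lt t u : delta00 (t ≺ u)
| d_in t X : delta00 (t ∈ X)
| d_imp f g : delta00 f -> delta00 g -> delta00 (f ⇒ g)
| d_and f g : delta00 f -> delta00 g -> delta00 (f /\ g)
| d_or f g : delta00 f -> delta00 g -> delta00 (f \/ g)
| d_all t f : delta00 f -> delta00 (fAllN (v0 ≺ shift_term t ⇒ f))
| d_ex t f : delta00 f -> delta00 (fExN (v0 ≺ shift_term t /\ f)).

Inductive sigma01 : form -> Prop :=
| sigma01_intro f : delta00 f -> sigma01 (fExN f).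

Inductive pi01 : form -> Prop :=
| pi01_intro f : delta00 f -> pi01 (fAllN f).

(** Replaces number variable 0 by its successor, keeping it free. *)
Definition inst_succ (f : form) : form :=
  subst (scons (tadd v0 tone) (fun n => tvar (S n))) (fun X => X) f.

Inductive RCA0 : form -> Prop :=
| ax_succ_ne0 : RCA0 (~ (tadd v0 tone ≐ tzero))
| ax_succ_inj : RCA0 (tadd v0 tone ≐ tadd v1 tone ⇒ v0 ≐ v1)
| ax_add0 : RCA0 (tadd v0 tzero ≐ v0)
| ax_addS : RCA0 (tadd v0 (tadd v1 tone) ≐ tadd (tadd v0 v1) tone)
| ax_mul0 : RCA0 (tmul v0 tzero ≐ tzero)
| ax_mulS : RCA0 (tmul v0 (tadd v1 tone) ≐ tadd (tmul v0 v1) v0)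
| ax_lt0 : RCA0 (~ (v0 ≺ tzero))
| ax_ltS : RCA0 (v0 ≺ tadd v1 tone <-> (v0 ≺ v1 \/ v0 ≐ v1))
| ax_induction f : sigma01 f ->
    RCA0 (inst_num tzero f /\ fAllN (f ⇒ inst_succ f) ⇒ fAllN f)
(* [shift_set f] does not mention the new set *)
| ax_comprehension f g : sigma01 f -> pi01 g ->
    RCA0 (fAllN (f <-> g) ⇒ fExS (fAllN (v0 ∈ 0 <-> shift_set f))).

(** * Partial, linear and interval orders in the language

    [P R L S F : nat] below are set-variable indices. *)

Definition all_in (P : nat) (f : form) : form := fAllN (v0 ∈ P ⇒ f).
Definition ex_in (P : nat) (f : form) : form := fExN (v0 ∈ P /\ f).

(** The usual code (i + j)^2 + i of the pair (i, j). *)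
Definition tpair (s t : term) : term :=
  tadd (tmul (tadd s t) (tadd s t)) s.

Definition rel (R : nat) (s t : term) : form := tpair s t ∈ R.
Definition strict (R : nat) (s t : term) : form := rel R s t /\ ~ (s ≐ t).

Definition sub_prod (R P Q : nat) : form :=
  fAllN (v0 ∈ R ⇒ ex_in P (ex_in Q (v2 ≐ tpair v1 v0))).

Definition partial_order (P R : nat) : form :=
  sub_prod R P P
  /\ all_in P (rel R v0 v0)
  /\ all_in P (all_in P (all_in P (rel R v2 v1 /\ rel R v1 v0 ⇒ rel R v2 v0)))
  /\ all_in P (all_in P (rel R v1 v0 /\ rel R v0 v1 ⇒ v1 ≐ v0)).

Definition linear_order (L S : nat) : form :=
  partial_order L S /\ all_in L (all_in L (rel S v1 v0 \/ rel S v0 v1)).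

(** (i1), with p = [v0] outside and, inside, p = [tvar 3], x = [v2], y = [v1],
    z = [v0]. *)
Definition interval_nonempty_convex (P L S F : nat) : form :=
  all_in P
    (ex_in L (rel F v1 v0)
     /\ all_in L (all_in L (all_in L
          (rel F (tvar 3) v2 /\ rel F (tvar 3) v1 /\
           strict S v2 v0 /\ strict S v0 v1 ⇒ rel F (tvar 3) v0)))).

(** (i2), with p = [v1], q = [v0] outside and, inside, p = [tvar 3],
    q = [v2], x = [v1], y = [v0]. *)
Definition interval_represents (P R L S F : nat) : form :=
  all_in P (all_in P
    (strict R v1 v0 <->
     all_in L (all_in L
       (rel F (tvar 3) v1 /\ rel F v2 v0 ⇒ strict S v1 v0)))).

(** Under the three set quantifiers L = 2, S = 1, F = 0, and [P], [R] are
    shifted by 3. *)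
Definition interval_order (P R : nat) : form :=
  fExS (fExS (fExS
    (linear_order 2 1
     /\ sub_prod 0 (3 + P) 2
     /\ interval_nonempty_convex (3 + P) 2 1 0
     /\ interval_represents (3 + P) (3 + R) 2 1 0))).

(** p0 = [tvar 3], q0 = [v2], p1 = [v1], q1 = [v0]. *)
Definition no_two_plus_two (P R : nat) : form :=
  all_in P (all_in P (all_in P (all_in P
    (strict R (tvar 3) v2 /\ strict R v1 v0 ⇒
     rel R (tvar 3) v0 \/ rel R v1 v2)))).

(* Main.v *)
From Stdlib Require Import List Arith Lia Ring Cantor.
From Stdlib Require Import Classical ClassicalEpsilon.
From Stdlib Require Import FunctionalExtensionality PropExtensionality.
Require Import Defs.
Import ListNotations.

(** By completeness of the calculus it suffices to argue in an arbitrary model of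
    [RCA0].  If [P] has an interval representation, two comparabilities
    [p0 < q0], [p1 < q1] with [p0 ≰ q1] and [p1 ≰ q0] would give a cycle among
    points of the intervals.

    Conversely, assume that [P] omits 2 + 2.  Then the sets of predecessors are
    linearly ordered by inclusion, but this order is not computable, so left
    endpoints cannot be used as points.  Instead, for [p <= s], a point [(s, p)]
    starts as the left endpoint of [p] in the finite order [P ∩ [0, s]] and becomes
    a cut of [P] by a recursion that decides for one further element after the
    other whether it lies to the left of the cut, doing so only when forced.  The
    set of elements to the left of a cut is a union of sets of predecessors, so the
    cuts are linearly ordered by inclusion, and whether one is included in the
    other is already decided at the later of their two stages.  [F z] consists of
    the cuts which have all predecessors of [z] but not [z] itself to their left.
    For incomparable [p] and [q], one of the points [(s, p)], [(s, q)] with [s]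
    above [p] and [q] lies in both intervals. *)

(** * Substitution *)

Lemma subst_term_comp s s' t :
  subst_term s (subst_term s' t) = subst_term (fun n => subst_term s (s' n)) t.
Proof. induction t; simpl; congruence. Qed.

Lemma subst_term_id t : subst_term tvar t = t.
Proof. induction t; simpl; congruence. Qed.

Lemma subst_term_scons_shift t s u :
  subst_term (scons t s) (shift_term u) = subst_term s u.
Proof. unfold shift_term. rewrite subst_term_comp. reflexivity. Qed.

Lemma up_num_comp s s' :
  (fun n => subst_term (up_num s) (up_num s' n))
  = up_num (fun n => subst_term s (s' n)).
Proof.
  extensionality n; destruct n as [|n]; [reflexivity|].
  unfold up_num; simpl. rewrite subst_term_scons_shift.
  unfold shift_term. now rewrite subst_term_comp.
Qed.

Lemma up_num_tvar : up_num tvar = tvar.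
Proof. extensionality n; now destruct n. Qed.

Lemma up_set_comp r r' : (fun X => up_set r (up_set r' X)) = up_set (fun X => r (r' X)).
Proof. extensionality n; now destruct n. Qed.

Lemma up_set_id : up_set (fun X => X) = (fun X => X).
Proof. extensionality n; now destruct n. Qed.

Lemma subst_comp f : forall s r s' r',
  subst s r (subst s' r' f)
  = subst (fun n => subst_term s (s' n)) (fun X => r (r' X)) f.
Proof.
  induction f; intros s' r s'' r'; simpl;
    rewrite ?subst_term_comp, ?IHf, ?IHf1, ?IHf2, ?up_num_comp, ?up_set_comp;
    reflexivity.
Qed.

Lemma subst_id f : subst tvar (fun X => X) f = f.
Proof.
  induction f; simpl;
    rewrite ?subst_term_id, ?up_num_tvar, ?up_set_id, ?IHf, ?IHf1, ?IHf2;
    reflexivity.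
Qed.

Lemma subst_inst_num s r t f :
  subst s r (inst_num t f) = inst_num (subst_term s t) (subst (up_num s) r f).
Proof.
  unfold inst_num. rewrite !subst_comp. f_equal.
  extensionality n; destruct n; simpl; [reflexivity|].
  unfold up_num; simpl. now rewrite subst_term_scons_shift, subst_term_id.
Qed.

Lemma subst_inst_set s r X f :
  subst s r (inst_set X f) = inst_set (r X) (subst s (up_set r) f).
Proof.
  unfold inst_set. rewrite !subst_comp. f_equal.
  - extensionality n. now rewrite subst_term_id.
  - extensionality n; now destruct n.
Qed.

Lemma subst_shift_num s r f :
  subst (up_num s) r (shift_num f) = shift_num (subst s r f).
Proof. unfold shift_num. rewrite !subst_comp. reflexivity. Qed.

Lemma subst_shift_set s r f :
  subst s (up_set r) (shift_set f) = shift_set (subst s r f).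
Proof.
  unfold shift_set. rewrite !subst_comp. f_equal.
  extensionality n. now rewrite subst_term_id.
Qed.

Lemma inst_num_subst_up t s r f :
  inst_num t (subst (up_num s) r f) = subst (scons t s) r f.
Proof.
  unfold inst_num. rewrite subst_comp. f_equal.
  extensionality n; destruct n; simpl; [reflexivity|].
  unfold up_num; simpl. now rewrite subst_term_scons_shift, subst_term_id.
Qed.

Lemma inst_set_subst_up X s r f :
  inst_set X (subst s (up_set r) f) = subst s (scons X r) f.
Proof.
  unfold inst_set. rewrite subst_comp. f_equal.
  - extensionality n. now rewrite subst_term_id.
  - extensionality n; now destruct n.
Qed.

(** All free variables, of both sorts, are below [N]; stating this through
    substitutions avoids a free-variable function. *)
Definition closed_above (N : nat) (f : form) : Prop :=
  forall s s' r r', (forall i, i < N -> s i = s' i) ->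
    (forall i, i < N -> r i = r' i) -> subst s r f = subst s' r' f.

Lemma term_closed_above t : exists N, forall s s',
  (forall i, i < N -> s i = s' i) -> subst_term s t = subst_term s' t.
Proof.
  induction t as [n| | |t [N1 H1] u [N2 H2]|t [N1 H1] u [N2 H2]].
  - exists (S n). intros s s' H. apply H. lia.
  - now exists 0.
  - now exists 0.
  - exists (N1 + N2). intros s s' H; simpl. f_equal; [apply H1|apply H2];
      intros i Hi; apply H; lia.
  - exists (N1 + N2). intros s s' H; simpl. f_equal; [apply H1|apply H2];
      intros i Hi; apply H; lia.
Qed.

Lemma form_closed_above f : exists N, closed_above N f.
Proof.
  unfold closed_above.
  induction f as [|t u|t u|t X|f [N1 H1] g [N2 H2]|f [N1 H1] g [N2 H2]
    |f [N1 H1] g [N2 H2]|f [N H]|f [N H]|f [N H]|f [N H]].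
  - now exists 0.
  - destruct (term_closed_above t) as [N1 H1], (term_closed_above u) as [N2 H2].
    exists (N1 + N2). intros s s' r r' Hs _; simpl. f_equal; [apply H1|apply H2];
      intros i Hi; apply Hs; lia.
  - destruct (term_closed_above t) as [N1 H1], (term_closed_above u) as [N2 H2].
    exists (N1 + N2). intros s s' r r' Hs _; simpl. f_equal; [apply H1|apply H2];
      intros i Hi; apply Hs; lia.
  - destruct (term_closed_above t) as [N1 H1].
    exists (N1 + S X). intros s s' r r' Hs Hr; simpl.
    f_equal; [apply H1; intros i Hi; apply Hs|apply Hr]; lia.
  - exists (N1 + N2). intros s s' r r' Hs Hr; simpl.
    f_equal; [apply H1|apply H2]; intros i Hi; (apply Hs || apply Hr); lia.
  - exists (N1 + N2). intros s s' r r' Hs Hr; simpl.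
    f_equal; [apply H1|apply H2]; intros i Hi; (apply Hs || apply Hr); lia.
  - exists (N1 + N2). intros s s' r r' Hs Hr; simpl.
    f_equal; [apply H1|apply H2]; intros i Hi; (apply Hs || apply Hr); lia.
  - exists N. intros s s' r r' Hs Hr; simpl. f_equal. apply H; [|assumption].
    intros [|i] Hi; unfold up_num; simpl; [reflexivity|]. rewrite Hs; [reflexivity|lia].
  - exists N. intros s s' r r' Hs Hr; simpl. f_equal. apply H; [|assumption].
    intros [|i] Hi; unfold up_num; simpl; [reflexivity|]. rewrite Hs; [reflexivity|lia].
  - exists N. intros s s' r r' Hs Hr; simpl. f_equal. apply H; [assumption|].
    intros [|i] Hi; simpl; [reflexivity|]. rewrite Hr; [reflexivity|lia].
  - exists N. intros s s' r r' Hs Hr; simpl. f_equal. apply H; [assumption|].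
    intros [|i] Hi; simpl; [reflexivity|]. rewrite Hr; [reflexivity|lia].
Qed.

Lemma closed_above_le M N f : M <= N -> closed_above M f -> closed_above N f.
Proof.
  intros HMN H s s' r r' Hs Hr. apply H; intros i Hi; [apply Hs|apply Hr]; lia.
Qed.

Lemma ctx_closed_above G : exists N, forall f, In f G -> closed_above N f.
Proof.
  induction G as [|g G [N1 H1]].
  - exists 0. intros f [].
  - destruct (form_closed_above g) as [N2 H2]. exists (N1 + N2).
    intros f [<-|Hf].
    + apply (closed_above_le N2); [lia|assumption].
    + apply (closed_above_le N1); [lia|now apply H1].
Qed.

(** * Derivations: weakening and substitution *)

Lemma incl_cons_cons {A : Type} (a : A) l l' : incl l l' -> incl (a :: l) (a :: l').
Proof. intros H x [<-|Hx]; [now left|right; now apply H]. Qed.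

Lemma prv_weaken T G f : prv T G f -> forall G', incl G G' -> prv T G' f.
Proof.
  induction 1; intros G' HG.
  - now apply prv_ax.
  - apply prv_hyp. now apply HG.
  - apply prv_raa, IHprv. now apply incl_cons_cons.
  - apply prv_imp_i, IHprv. now apply incl_cons_cons.
  - apply prv_imp_e with f; auto.
  - apply prv_and_i; auto.
  - apply prv_and_e1 with g; auto.
  - apply prv_and_e2 with f; auto.
  - apply prv_or_i1; auto.
  - apply prv_or_i2; auto.
  - apply prv_or_e with f g; auto using incl_cons_cons.
  - apply prv_allN_i, IHprv. now apply incl_map.
  - apply prv_allN_e; auto.
  - apply prv_exN_i with t; auto.
  - apply prv_exN_e with f; auto using incl_cons_cons, incl_map.
  - apply prv_allS_i, IHprv. now apply incl_map.
  - apply prv_allS_e; auto.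
  - apply prv_exS_i with X; auto.
  - apply prv_exS_e with f; auto using incl_cons_cons, incl_map.
  - apply prv_eq_refl.
  - apply prv_eq_subst with t; auto.
Qed.

Lemma prv_cut T G f g : prv T G f -> prv T (f :: G) g -> prv T G g.
Proof. intros Hf Hg. apply prv_imp_e with f; [now apply prv_imp_i|assumption]. Qed.

(** Simultaneous substitution into an axiom is obtained by substituting for one
    variable at a time; the substituted terms are shifted so that the later
    steps undo the shift instead of touching them. *)
Lemma prv_subst_num_below T N : forall s f, (forall G, prv T G f) ->
  forall G, prv T G
    (subst (fun i => if i <? N then s i else tvar (i - N)) (fun X => X) f).
Proof.
  induction N as [|N IH]; intros s f Hf G.
  - replace (fun i => _) with tvar; [now rewrite subst_id|].
    extensionality i; simpl. f_equal. lia.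
  - specialize (IH (fun i => s (S i))
      (inst_num (subst_term (fun n => tvar (N + n)) (s 0)) f)).
    assert (H : forall G, prv T G (inst_num (subst_term (fun n => tvar (N + n)) (s 0)) f)).
    { intros G'. apply prv_allN_e, prv_allN_i, Hf. }
    specialize (IH H G). unfold inst_num in IH. rewrite subst_comp in IH.
    erewrite (f_equal (fun s => subst s _ f)); [exact IH|].
    extensionality i; destruct i as [|i]; simpl.
    + rewrite subst_term_comp. rewrite <- (subst_term_id (s 0)) at 1. f_equal.
      extensionality n; simpl.
      destruct (Nat.ltb_spec (N + n) N); [lia|]. f_equal. lia.
    + reflexivity.
Qed.

Lemma prv_subst_set_below T N : forall r f, (forall G, prv T G f) ->
  forall G, prv T G
    (subst tvar (fun i => if i <? N then r i else i - N) f).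
Proof.
  induction N as [|N IH]; intros r f Hf G.
  - replace (fun i => _) with (fun X : nat => X); [now rewrite subst_id|].
    extensionality i; simpl. lia.
  - specialize (IH (fun i => r (S i)) (inst_set (N + r 0) f)).
    assert (H : forall G, prv T G (inst_set (N + r 0) f)).
    { intros G'. apply prv_allS_e, prv_allS_i, Hf. }
    specialize (IH H G). unfold inst_set in IH. rewrite subst_comp in IH.
    erewrite (f_equal (fun r => subst _ r f)); [exact IH|].
    extensionality i; destruct i as [|i]; simpl.
    + destruct (Nat.ltb_spec (N + r 0) N); lia.
    + reflexivity.
Qed.

(** Set variables are substituted first, number variables afterwards. Both partial substitutions
    follow [r] and [s] only below [N], which suffices because [f] has no other free variables. *)
Lemma prv_ax_subst T f s r G : T f -> prv T G (subst s r f).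
Proof.
  intros Hf. destruct (form_closed_above f) as [N HN].
  pose proof (prv_subst_set_below T N r f (fun G => prv_ax T G f Hf)) as H1.
  pose proof (prv_subst_num_below T N s _ H1 G) as H2.
  rewrite subst_comp in H2. erewrite HN; [exact H2| |]; intros i Hi; simpl;
    apply Nat.ltb_lt in Hi; now rewrite Hi.
Qed.

Lemma map_subst_shift_num s r G :
  map (subst (up_num s) r) (map shift_num G) = map shift_num (map (subst s r) G).
Proof. rewrite !map_map. apply map_ext. intros f. apply subst_shift_num. Qed.

Lemma map_subst_shift_set s r G :
  map (subst s (up_set r)) (map shift_set G) = map shift_set (map (subst s r) G).
Proof. rewrite !map_map. apply map_ext. intros f. apply subst_shift_set. Qed.

(** The axiom case is [prv_ax_subst]; the other cases are commutation of substitutions. The Henkin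
    witnesses use this to rename a fresh variable. *)
Lemma prv_subst T G f : prv T G f ->
  forall s r, prv T (map (subst s r) G) (subst s r f).
Proof.
  induction 1; intros s r; simpl in *.
  - now apply prv_ax_subst.
  - apply prv_hyp. now apply in_map.
  - apply prv_raa, IHprv.
  - apply prv_imp_i, IHprv.
  - apply prv_imp_e with (subst s r f); auto.
  - apply prv_and_i; auto.
  - eapply prv_and_e1; auto.
  - eapply prv_and_e2; auto.
  - apply prv_or_i1; auto.
  - apply prv_or_i2; auto.
  - apply prv_or_e with (subst s r f) (subst s r g); auto.
  - apply prv_allN_i. rewrite <- map_subst_shift_num. apply IHprv.
  - rewrite subst_inst_num. apply prv_allN_e. apply IHprv.
  - apply prv_exN_i with (subst_term s t). rewrite <- subst_inst_num. apply IHprv.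
  - apply prv_exN_e with (subst (up_num s) r f); [apply IHprv1|].
    rewrite <- map_subst_shift_num, <- subst_shift_num. apply IHprv2.
  - apply prv_allS_i. rewrite <- map_subst_shift_set. apply IHprv.
  - rewrite subst_inst_set. apply prv_allS_e. apply IHprv.
  - apply prv_exS_i with (r X). rewrite <- subst_inst_set. apply IHprv.
  - apply prv_exS_e with (subst s (up_set r) f); [apply IHprv1|].
    rewrite <- map_subst_shift_set, <- subst_shift_set. apply IHprv2.
  - apply prv_eq_refl.
  - rewrite subst_inst_num. apply prv_eq_subst with (subst_term s t); [apply IHprv1|].
    rewrite <- subst_inst_num. apply IHprv2.
Qed.

(** * Completeness *)

Definition consistent (T : form -> Prop) (G : list form) : Prop := ~ prv T G fBot.

(** Free variables play the role of Henkin constants: a context is finite, so some [k] occurs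
    neither in it nor in [f], and a refutation involving [k] becomes the second premise of
    existential elimination. *)
Lemma witness_num T G f : consistent T (fExN f :: G) ->
  exists k, consistent T (inst_num (tvar k) f :: fExN f :: G).
Proof.
  intros HG. destruct (ctx_closed_above (f :: fExN f :: G)) as [k Hk].
  exists k. intros Hbot. apply HG.
  apply prv_exN_e with f; [apply prv_hyp; now left|].
  (* The fresh [k] becomes the newly bound index 0 and every other index is shifted, so the context
     turns into its shifted copy and the instance into [f]. *)
  pose proof (prv_subst _ _ _ Hbot
    (fun i => if i =? k then tvar 0 else tvar (S i)) (fun X => X)) as H.
  cbn [map] in H.
  replace (subst _ _ (inst_num (tvar k) f)) with f in H.
  - eapply prv_weaken; [exact H|]. apply incl_cons_cons.
    intros h Hh. change (In h (map shift_num (fExN f :: G))).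
    change (In h (map (subst (fun i => if i =? k then tvar 0 else tvar (S i))
      (fun X => X)) (fExN f :: G))) in Hh.
    apply in_map_iff in Hh as [g [<- Hg]]. apply in_map_iff. exists g.
    split; [|assumption]. unfold shift_num. apply (Hk g); [now right| |reflexivity].
    intros i Hi. destruct (Nat.eqb_spec i k); [lia|reflexivity].
  - unfold inst_num. rewrite subst_comp. rewrite <- (subst_id f) at 1.
    apply (Hk f); [now left| |reflexivity].
    intros [|i] Hi; simpl.
    + now rewrite Nat.eqb_refl.
    + destruct (Nat.eqb_spec i k); [lia|reflexivity].
Qed.

Lemma witness_set T G f : consistent T (fExS f :: G) ->
  exists k, consistent T (inst_set k f :: fExS f :: G).
Proof.
  intros HG. destruct (ctx_closed_above (f :: fExS f :: G)) as [k Hk].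
  exists k. intros Hbot. apply HG.
  apply prv_exS_e with f; [apply prv_hyp; now left|].
  pose proof (prv_subst _ _ _ Hbot tvar
    (fun i => if i =? k then 0 else S i)) as H.
  cbn [map] in H.
  replace (subst _ _ (inst_set k f)) with f in H.
  - eapply prv_weaken; [exact H|]. apply incl_cons_cons.
    intros h Hh. change (In h (map shift_set (fExS f :: G))).
    change (In h (map (subst tvar (fun i => if i =? k then 0 else S i))
      (fExS f :: G))) in Hh.
    apply in_map_iff in Hh as [g [<- Hg]]. apply in_map_iff. exists g.
    split; [|assumption]. unfold shift_set. apply (Hk g); [now right|reflexivity|].
    intros i Hi. destruct (Nat.eqb_spec i k); [lia|reflexivity].
  - unfold inst_set. rewrite subst_comp. rewrite <- (subst_id f) at 1.
    apply (Hk f); [now left|reflexivity|].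
    intros [|i] Hi; simpl.
    + now rewrite Nat.eqb_refl.
    + destruct (Nat.eqb_spec i k); [lia|reflexivity].
Qed.

Lemma prv_by_cases T G f : prv T (f :: G) fBot -> prv T (fNot f :: G) fBot ->
  prv T G fBot.
Proof.
  intros H1 H2. apply prv_cut with f; [|exact H1]. now apply prv_raa.
Qed.

Lemma henkin_step T G f : consistent T G -> exists G', incl G G' /\
  consistent T G' /\ (In f G' \/ In (fNot f) G') /\
  (forall g, f = fExN g -> In f G' -> exists k, In (inst_num (tvar k) g) G') /\
  (forall g, f = fExS g -> In f G' -> exists k, In (inst_set k g) G').
Proof.
  intros HG. destruct (classic (consistent T (f :: G))) as [Hf|Hf].
  - destruct f; try (eexists; split; [apply incl_tl, incl_refl|];
      split; [exact Hf|]; split; [left; now left|]; split; intros; discriminate).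
    + destruct (witness_num _ _ _ Hf) as [k Hk]. eexists. split;
      [apply incl_tl, incl_tl, incl_refl|]. split; [exact Hk|].
      split; [left; right; now left|]. split; [|intros; discriminate].
      intros g [= <-] _. exists k. now left.
    + destruct (witness_set _ _ _ Hf) as [k Hk]. eexists. split;
      [apply incl_tl, incl_tl, incl_refl|]. split; [exact Hk|].
      split; [left; right; now left|]. split; [intros; discriminate|].
      intros g [= <-] _. exists k. now left.
  - assert (Hn : consistent T (fNot f :: G)).
    { intros Hn. apply Hf. intros Hf'. apply HG. now apply prv_by_cases with f. }
    exists (fNot f :: G). split; [apply incl_tl, incl_refl|]. split; [exact Hn|].
    split; [right; now left|].
    (* [f] is absent from the new context, so the witness clauses are vacuous. *)
    assert (Hnf : ~ In f (fNot f :: G)).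
    { intros Hin. apply Hn. apply prv_imp_e with f; apply prv_hyp; [now left|exact Hin]. }
    split; intros g _ Hin; contradiction.
Qed.

Fixpoint term_code (t : term) : nat :=
  match t with
  | tvar n => to_nat (0, n)
  | tzero => to_nat (1, 0)
  | tone => to_nat (2, 0)
  | tadd t u => to_nat (3, to_nat (term_code t, term_code u))
  | tmul t u => to_nat (4, to_nat (term_code t, term_code u))
  end.

(** The code of a formula is the step of the Lindenbaum chain that decides it. *)
Fixpoint form_code (f : form) : nat :=
  match f with
  | fBot => to_nat (0, 0)
  | fEq t u => to_nat (1, to_nat (term_code t, term_code u))
  | fLt t u => to_nat (2, to_nat (term_code t, term_code u))
  | fIn t X => to_nat (3, to_nat (term_code t, X))
  | fImp f g => to_nat (4, to_nat (form_code f, form_code g))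
  | fAnd f g => to_nat (5, to_nat (form_code f, form_code g))
  | fOr f g => to_nat (6, to_nat (form_code f, form_code g))
  | fAllN f => to_nat (7, form_code f)
  | fExN f => to_nat (8, form_code f)
  | fAllS f => to_nat (9, form_code f)
  | fExS f => to_nat (10, form_code f)
  end.

Lemma to_nat_inj a b c d : to_nat (a, b) = to_nat (c, d) -> a = c /\ b = d.
Proof.
  intros H. apply (f_equal of_nat) in H. rewrite !cancel_of_to in H.
  now injection H.
Qed.

Local Ltac code_inj H Hl Hr :=
  apply to_nat_inj in H; destruct H as [Hl Hr]; try discriminate.

Lemma term_code_inj t : forall u, term_code t = term_code u -> t = u.
Proof.
  induction t; destruct u; cbn [term_code]; intros H; code_inj H Hl Hr; subst;
    try reflexivity; code_inj Hr Ht Hu; f_equal; auto.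
Qed.

Lemma form_code_inj f : forall g, form_code f = form_code g -> f = g.
Proof.
  induction f; destruct g; cbn [form_code]; intros H; code_inj H Hl Hr;
    try reflexivity; try (f_equal; auto; fail); code_inj Hr Ht Hu;
    f_equal; auto using term_code_inj.
Qed.

Record henkin (T : form -> Prop) (H : form -> Prop) : Prop := {
  hk_consistent : ~ H fBot;
  hk_closed : forall G f, (forall g, In g G -> H g) -> prv T G f -> H f;
  hk_complete : forall f, H f \/ H (fNot f);
  hk_num : forall f, H (fExN f) -> exists t, H (inst_num t f);
  hk_set : forall f, H (fExS f) -> exists X, H (inst_set X f) }.

(** Step [n] treats the formula with code [n], if there is one. All stages are finite contexts, so
    fresh variables never run out; the theory consists of what some stage derives. *)
Lemma lindenbaum T G0 : consistent T G0 ->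
  exists H, henkin T H /\ forall g, In g G0 -> H g.
Proof.
  intros HG0.
  pose (stage := {G | consistent T G}).
  assert (Hstep : forall (G : stage) n, exists G' : stage,
    incl (proj1_sig G) (proj1_sig G') /\
    forall f, form_code f = n ->
      (In f (proj1_sig G') \/ In (fNot f) (proj1_sig G')) /\
      (forall g, f = fExN g -> In f (proj1_sig G') ->
         exists k, In (inst_num (tvar k) g) (proj1_sig G')) /\
      (forall g, f = fExS g -> In f (proj1_sig G') ->
         exists k, In (inst_set k g) (proj1_sig G'))).
  { intros [G HG] n. destruct (classic (exists f, form_code f = n)) as [[f <-]|Hn].
    - destruct (henkin_step T G f HG) as (G' & Hincl & HG' & Hf).
      exists (exist _ G' HG'). split; [exact Hincl|]. intros h Hh.
      apply form_code_inj in Hh. subst h. exact Hf.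
    - exists (exist _ G HG). split; [apply incl_refl|]. intros f Hf.
      exfalso. eauto. }
  pose (next G n := constructive_indefinite_description _ (Hstep G n)).
  pose (chain := fix chain n : stage :=
    match n with 0 => exist _ G0 HG0 | S n => proj1_sig (next (chain n) n) end).
  assert (Hchain := fun n => proj2_sig (next (chain n) n)).
  assert (Hmon : forall m n, m <= n ->
    incl (proj1_sig (chain m)) (proj1_sig (chain n))).
  { intros m n Hmn. induction Hmn as [|n Hmn IH]; [apply incl_refl|].
    apply incl_tran with (1 := IH). exact (proj1 (Hchain n)). }
  pose (H f := exists n, prv T (proj1_sig (chain n)) f).
  assert (Hin : forall f n, In f (proj1_sig (chain n)) -> H f).
  { intros f n Hf. exists n. now apply prv_hyp. }
  assert (Hcons : ~ H fBot).
  { intros [n Hn]. exact (proj2_sig (chain n) Hn). }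
  assert (Hcl : forall G f, (forall g, In g G -> H g) -> prv T G f -> H f).
  (* Hypotheses are discharged one by one into implications, so only two stages have to be merged at
     a time. *)
  { intros G; induction G as [|g G IH]; intros f Hg Hf.
    - exists 0. apply prv_weaken with (1 := Hf). intros h [].
    - assert (H (fImp g f)) as [n Hn].
      { apply IH; [intros h Hh; apply Hg; now right|]. now apply prv_imp_i. }
      destruct (Hg g (or_introl eq_refl)) as [m Hm].
      exists (n + m). apply prv_imp_e with g;
        [apply prv_weaken with (1 := Hn)|apply prv_weaken with (1 := Hm)];
        apply Hmon; lia. }
  assert (Hex : forall f, H f -> H (fNot f) -> False).
  { intros f H1 H2. apply Hcons. apply Hcl with [f; fNot f].
    - intros g [<-|[<-|[]]]; assumption.
    - apply prv_imp_e with f; apply prv_hyp; simpl; auto. }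
  assert (Hs : forall f, (exists n, In f (proj1_sig (chain n)) \/
      In (fNot f) (proj1_sig (chain n))) /\
      (forall g, f = fExN g -> H f -> exists k, H (inst_num (tvar k) g)) /\
      (forall g, f = fExS g -> H f -> exists k, H (inst_set k g))).
  { intros f.
    destruct (proj2 (Hchain (form_code f)) f eq_refl) as (H1 & H2 & H3).
    pose proof (fun h => Hin h (S (form_code f))) as Hin'.
    split; [exists (S (form_code f)); exact H1|].
    split; intros g -> Hg; (destruct H1 as [H1|H1]; [|exfalso; eapply Hex; eauto]).
    - destruct (H2 g eq_refl H1) as [k Hk]. eauto.
    - destruct (H3 g eq_refl H1) as [k Hk]. eauto. }
  exists H. split; [split|].
  - exact Hcons.
  - exact Hcl.
  - intros f. destruct (Hs f) as [[n [Hf|Hf]] _]; eauto.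
  - intros f Hf. destruct (Hs (fExN f)) as [_ [Hw _]].
    destruct (Hw f eq_refl Hf) as [k Hk]. eauto.
  - intros f Hf. destruct (Hs (fExS f)) as [_ [_ Hw]].
    destruct (Hw f eq_refl Hf) as [k Hk]. eauto.
  - intros g Hg. apply (Hin g 0). exact Hg.
Qed.

(** * Structures, satisfaction and the term model *)

Record structure : Type := {
  num : Type;
  set : Type;
  nzero : num;
  none : num;
  nadd : num -> num -> num;
  nmul : num -> num -> num;
  nlt : num -> num -> Prop;
  nmem : num -> set -> Prop }.

Fixpoint eval (M : structure) (e : nat -> num M) (t : term) : num M :=
  match t with
  | tvar n => e n
  | tzero => nzero M
  | tone => none M
  | tadd t u => nadd M (eval M e t) (eval M e u)
  | tmul t u => nmul M (eval M e t) (eval M e u)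
  end.

Fixpoint sat (M : structure) (e : nat -> num M) (r : nat -> set M) (f : form) : Prop :=
  match f with
  | fBot => False
  | fEq t u => eval M e t = eval M e u
  | fLt t u => nlt M (eval M e t) (eval M e u)
  | fIn t X => nmem M (eval M e t) (r X)
  | fImp f g => sat M e r f -> sat M e r g
  | fAnd f g => sat M e r f /\ sat M e r g
  | fOr f g => sat M e r f \/ sat M e r g
  | fAllN f => forall x, sat M (scons x e) r f
  | fExN f => exists x, sat M (scons x e) r f
  | fAllS f => forall X, sat M e (scons X r) f
  | fExS f => exists X, sat M e (scons X r) f
  end.

Lemma eval_subst M e s t : eval M e (subst_term s t) = eval M (fun n => eval M e (s n)) t.
Proof. induction t; simpl; congruence. Qed.

Lemma eval_up M e s x :
  (fun n => eval M (scons x e) (up_num s n)) = scons x (fun n => eval M e (s n)).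
Proof.
  extensionality n; destruct n as [|n]; [reflexivity|].
  unfold up_num, shift_term; simpl. now rewrite eval_subst.
Qed.

Lemma up_set_scons {A : Type} (X : A) (r : nat -> A) (r' : nat -> nat) :
  (fun n => scons X r (up_set r' n)) = scons X (fun n => r (r' n)).
Proof. extensionality n; now destruct n. Qed.

Lemma sat_subst M f : forall e r s r',
  sat M e r (subst s r' f)
  <-> sat M (fun n => eval M e (s n)) (fun X => r (r' X)) f.
Proof.
  induction f; intros e r s' r'; simpl; rewrite ?eval_subst; try reflexivity.
  - now rewrite IHf1, IHf2.
  - now rewrite IHf1, IHf2.
  - now rewrite IHf1, IHf2.
  - split; intros H x; specialize (H x).
    + now rewrite IHf, eval_up in H.
    + now rewrite IHf, eval_up.
  - split; intros [x H]; exists x.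
    + now rewrite IHf, eval_up in H.
    + now rewrite IHf, eval_up.
  - split; intros H x; specialize (H x).
    + now rewrite IHf, up_set_scons in H.
    + now rewrite IHf, up_set_scons.
  - split; intros [x H]; exists x.
    + now rewrite IHf, up_set_scons in H.
    + now rewrite IHf, up_set_scons.
Qed.

Section TermModel.
Variables T H : form -> Prop.
Hypothesis HH : henkin T H.

Lemma hk_mp f g : H (fImp f g) -> H f -> H g.
Proof.
  intros Hfg Hf. apply (hk_closed _ _ HH [fImp f g; f]).
  - intros h [<-|[<-|[]]]; assumption.
  - apply prv_imp_e with f; apply prv_hyp; simpl; auto.
Qed.

Lemma hk_contra f : H f -> H (fNot f) -> False.
Proof. intros Hf Hn. apply (hk_consistent _ _ HH). now apply hk_mp with f. Qed.

Lemma hk_derive1 f g : prv T [f] g -> H f -> H g.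
Proof.
  intros Hp Hf. apply (hk_closed _ _ HH [f]); [|assumption].
  now intros h [<-|[]].
Qed.

Lemma hk_imp f g : H (fImp f g) <-> (H f -> H g).
Proof.
  split; [intros; now apply hk_mp with f|].
  intros Hfg. destruct (hk_complete _ _ HH f) as [Hf|Hf].
  - apply hk_derive1 with g; [|auto]. apply prv_imp_i, prv_hyp. simpl; auto.
  - apply hk_derive1 with (fNot f); [|auto]. apply prv_imp_i, prv_raa.
    apply prv_imp_e with f; apply prv_hyp; simpl; auto.
Qed.

Lemma hk_and f g : H (fAnd f g) <-> H f /\ H g.
Proof.
  split.
  - intros Hfg. split; revert Hfg; apply hk_derive1;
      [apply prv_and_e1 with g|apply prv_and_e2 with f]; apply prv_hyp; simpl; auto.
  - intros [Hf Hg]. apply (hk_closed _ _ HH [f; g]).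
    + intros h [<-|[<-|[]]]; assumption.
    + apply prv_and_i; apply prv_hyp; simpl; auto.
Qed.

Lemma hk_or f g : H (fOr f g) <-> H f \/ H g.
Proof.
  split.
  - intros Hfg. destruct (hk_complete _ _ HH f) as [Hf|Hf]; [now left|right].
    apply (hk_closed _ _ HH [fOr f g; fNot f]).
    + intros h [<-|[<-|[]]]; assumption.
    + apply prv_or_e with f g; [apply prv_hyp; simpl; auto| |apply prv_hyp; simpl; auto].
      apply prv_raa, prv_imp_e with f; apply prv_hyp; simpl; auto.
  - intros [Hf|Hg]; [revert Hf|revert Hg]; apply hk_derive1;
      [apply prv_or_i1|apply prv_or_i2]; apply prv_hyp; simpl; auto.
Qed.

Lemma hk_exN f : H (fExN f) <-> exists t, H (inst_num t f).
Proof.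
  split; [apply (hk_num _ _ HH)|]. intros [t Ht]. revert Ht. apply hk_derive1.
  apply prv_exN_i with t, prv_hyp. simpl; auto.
Qed.

Lemma hk_exS f : H (fExS f) <-> exists X, H (inst_set X f).
Proof.
  split; [apply (hk_set _ _ HH)|]. intros [X HX]. revert HX. apply hk_derive1.
  apply prv_exS_i with X, prv_hyp. simpl; auto.
Qed.

Lemma inst_shift_num_id f :
  inst_num (tvar 0) (subst (up_num (fun n => tvar (S n))) (fun X => X) f) = f.
Proof.
  rewrite inst_num_subst_up. rewrite <- (subst_id f) at 2. f_equal.
  extensionality n; now destruct n.
Qed.

Lemma inst_shift_set_id f : inst_set 0 (subst tvar (up_set S) f) = f.
Proof.
  rewrite inst_set_subst_up. rewrite <- (subst_id f) at 2. f_equal.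
  extensionality n; now destruct n.
Qed.

(** If the universal formula failed, its negation would belong to the theory, hence classically the
    existence of a counterexample, and the theory names one by a term. *)
Lemma hk_allN f : H (fAllN f) <-> forall t, H (inst_num t f).
Proof.
  split.
  - intros Hf t. revert Hf. apply hk_derive1. apply prv_allN_e, prv_hyp. simpl; auto.
  - intros Hf. destruct (hk_complete _ _ HH (fAllN f)) as [Ha|Ha]; [exact Ha|exfalso].
    assert (He : H (fExN (fNot f))).
    { revert Ha. apply hk_derive1. apply prv_raa.
      apply prv_imp_e with (fAllN f); [apply prv_hyp; simpl; auto|].
      apply prv_allN_i, prv_raa. cbn [map].
      apply prv_imp_e with (shift_num (fExN (fNot f))); [apply prv_hyp; simpl; auto|].
      apply prv_exN_i with (tvar 0).
      fold (subst (up_num (fun n => tvar (S n))) (fun X => X) (fNot f)).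
      rewrite inst_shift_num_id. apply prv_hyp. simpl; auto. }
    apply hk_exN in He as [t Ht]. apply hk_contra with (1 := Hf t). exact Ht.
Qed.

Lemma hk_allS f : H (fAllS f) <-> forall X, H (inst_set X f).
Proof.
  split.
  - intros Hf t. revert Hf. apply hk_derive1. apply prv_allS_e, prv_hyp. simpl; auto.
  - intros Hf. destruct (hk_complete _ _ HH (fAllS f)) as [Ha|Ha]; [exact Ha|exfalso].
    assert (He : H (fExS (fNot f))).
    { revert Ha. apply hk_derive1. apply prv_raa.
      apply prv_imp_e with (fAllS f); [apply prv_hyp; simpl; auto|].
      apply prv_allS_i, prv_raa. cbn [map].
      apply prv_imp_e with (shift_set (fExS (fNot f))); [apply prv_hyp; simpl; auto|].
      apply prv_exS_i with 0.
      fold (subst tvar (up_set S) (fNot f)).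
      rewrite inst_shift_set_id. apply prv_hyp. simpl; auto. }
    apply hk_exS in He as [X HX]. apply hk_contra with (1 := Hf X). exact HX.
Qed.

Lemma hk_refl t : H (fEq t t).
Proof. apply (hk_closed _ _ HH []); [intros g []|]. apply prv_eq_refl. Qed.

Lemma hk_rewrite f t u : H (fEq t u) -> H (inst_num t f) -> H (inst_num u f).
Proof.
  intros He Hf. apply (hk_closed _ _ HH [fEq t u; inst_num t f]).
  - intros h [<-|[<-|[]]]; assumption.
  - apply prv_eq_subst with t; apply prv_hyp; simpl; auto.
Qed.

Lemma inst_shift_term t u : subst_term (scons t tvar) (shift_term u) = u.
Proof. now rewrite subst_term_scons_shift, subst_term_id. Qed.

Lemma hk_sym t u : H (fEq t u) -> H (fEq u t).
Proof.
  intros He. pose proof (hk_rewrite (fEq (tvar 0) (shift_term t)) t u He) as Hr.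
  unfold inst_num in Hr; simpl in Hr. rewrite !inst_shift_term in Hr.
  apply Hr, hk_refl.
Qed.

Lemma hk_trans t u v : H (fEq t u) -> H (fEq u v) -> H (fEq t v).
Proof.
  intros H1 H2. pose proof (hk_rewrite (fEq (shift_term t) (tvar 0)) u v H2) as Hr.
  unfold inst_num in Hr; simpl in Hr. rewrite !inst_shift_term in Hr. auto.
Qed.

(** The two terms are replaced one after the other; the one not being replaced is shifted so that
    the rule for a single variable leaves it alone. *)
Lemma hk_congr f t t' u u' : H (fEq t t') -> H (fEq u u') ->
  H (subst (scons t (scons u tvar)) (fun X => X) f) ->
  H (subst (scons t' (scons u' tvar)) (fun X => X) f).
Proof.
  intros Ht Hu Hf.
  pose proof (hk_rewrite
    (subst (scons (tvar 0) (scons (shift_term u) (fun n => tvar (S n))))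
       (fun X => X) f) t t' Ht) as H1.
  pose proof (hk_rewrite
    (subst (scons (shift_term t') (scons (tvar 0) (fun n => tvar (S n))))
       (fun X => X) f) u u' Hu) as H2.
  unfold inst_num in H1, H2. rewrite !subst_comp in H1, H2.
  assert (E : forall a b c d, (fun n => subst_term (scons a tvar)
      (scons (tvar 0) (scons (shift_term b) (fun n => tvar (S n))) n))
      = scons a (scons b tvar) /\
      (fun n => subst_term (scons d tvar)
      (scons (shift_term c) (scons (tvar 0) (fun n => tvar (S n))) n))
      = scons c (scons d tvar)).
  { intros a b c d; split; extensionality n; destruct n as [|[|n]]; simpl;
      auto using inst_shift_term. }
  rewrite !(fun a b => proj1 (E a b a b)) in H1.
  rewrite !(fun c d => proj2 (E c d c d)) in H2. auto.
Qed.

(** Satisfaction reads number equality as true equality, so terms are taken modulo equality in the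
    theory. With classes as predicates, the extensionality axioms identify the classes of equal
    terms. *)
Definition tclass : Type := {P : term -> Prop | exists t, P = fun u => H (fEq t u)}.
Definition cls (t : term) : tclass := exist _ (fun u => H (fEq t u)) (ex_intro _ t eq_refl).
Definition rep (x : tclass) : term :=
  proj1_sig (constructive_indefinite_description _ (proj2_sig x)).

Lemma cls_eq t u : cls t = cls u <-> H (fEq t u).
Proof.
  split.
  - intros E. apply (f_equal (fun x => proj1_sig x u)) in E. simpl in E.
    rewrite E. apply hk_refl.
  - intros E. assert (E' : (fun v => H (fEq t v)) = (fun v => H (fEq u v))).
    { extensionality v. apply propositional_extensionality. split; intros Hv.
      - apply hk_trans with t; [now apply hk_sym|assumption].
      - now apply hk_trans with u. }
    unfold cls. apply eq_sig_hprop; [intros; apply proof_irrelevance|exact E'].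
Qed.

Lemma cls_rep x : cls (rep x) = x.
Proof.
  unfold rep. destruct (constructive_indefinite_description _ _) as [t Ht].
  simpl. destruct x as [P HP]. simpl in Ht. unfold cls.
  apply eq_sig_hprop; [intros; apply proof_irrelevance|now symmetry].
Qed.

Lemma rep_cls t : H (fEq t (rep (cls t))).
Proof. apply cls_eq. now rewrite cls_rep. Qed.

(** Sets are the set variables themselves: a set witness is always a variable, and no quotient is
    taken because the language has no equality of sets. *)
Definition term_model : structure := {|
  num := tclass;
  set := nat;
  nzero := cls tzero;
  none := cls tone;
  nadd x y := cls (tadd (rep x) (rep y));
  nmul x y := cls (tmul (rep x) (rep y));
  nlt x y := H (fLt (rep x) (rep y));
  nmem x X := H (fIn (rep x) X) |}.

Lemma eval_term_model s t :
  eval term_model (fun n => cls (s n)) t = cls (subst_term s t).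
Proof.
  induction t as [n| | |t IHt u IHu|t IHt u IHu]; simpl; try reflexivity.
  - rewrite IHt, IHu. symmetry. apply cls_eq.
    pose proof (hk_congr (fEq (tadd (shift_term (shift_term (subst_term s t)))
      (shift_term (shift_term (subst_term s u)))) (tadd (tvar 0) (tvar 1)))
      _ _ _ _ (rep_cls (subst_term s t)) (rep_cls (subst_term s u))) as Hc.
    simpl in Hc. rewrite !subst_term_scons_shift, !subst_term_id in Hc.
    apply Hc, hk_refl.
  - rewrite IHt, IHu. symmetry. apply cls_eq.
    pose proof (hk_congr (fEq (tmul (shift_term (shift_term (subst_term s t)))
      (shift_term (shift_term (subst_term s u)))) (tmul (tvar 0) (tvar 1)))
      _ _ _ _ (rep_cls (subst_term s t)) (rep_cls (subst_term s u))) as Hc.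
    simpl in Hc. rewrite !subst_term_scons_shift, !subst_term_id in Hc.
    apply Hc, hk_refl.
Qed.

Lemma cls_scons t s : (fun n => cls (scons t s n)) = scons (cls t) (fun n => cls (s n)).
Proof. extensionality n; now destruct n. Qed.

(** The truth lemma. It is stated for all substitutions so that quantifiers can be passed; number
    quantifiers use that every class has a representative. *)
Lemma sat_term_model f : forall s r,
  sat term_model (fun n => cls (s n)) r f <-> H (subst s r f).
Proof.
  induction f as [|t u|t u|t X|f IHf g IHg|f IHf g IHg|f IHf g IHg|f IHf|f IHf|f IHf|f IHf];
    intros s r; cbn [sat subst]; rewrite ?eval_term_model.
  - split; [contradiction|apply (hk_consistent _ _ HH)].
  - apply cls_eq.
  - simpl. split; apply (hk_congr (fLt (tvar 0) (tvar 1)));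
      (apply hk_sym; apply rep_cls) || apply rep_cls.
  - simpl. split; apply (hk_congr (fIn (tvar 0) (r X)) _ _ tzero tzero);
      (apply hk_refl || (apply hk_sym; apply rep_cls) || apply rep_cls).
  - now rewrite hk_imp, IHf, IHg.
  - now rewrite hk_and, IHf, IHg.
  - now rewrite hk_or, IHf, IHg.
  - rewrite hk_allN. split.
    + intros Hf t. rewrite inst_num_subst_up, <- IHf, cls_scons. apply Hf.
    + intros Hf x. rewrite <- (cls_rep x), <- cls_scons, IHf, <- inst_num_subst_up.
      apply Hf.
  - rewrite hk_exN. split.
    + intros [x Hf]. exists (rep x).
      now rewrite inst_num_subst_up, <- IHf, cls_scons, cls_rep.
    + intros [t Hf]. exists (cls t). now rewrite <- cls_scons, IHf, <- inst_num_subst_up.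
  - rewrite hk_allS. split; intros Hf X; specialize (Hf X).
    + now rewrite inst_set_subst_up, <- IHf.
    + now rewrite IHf, <- inst_set_subst_up.
  - rewrite hk_exS. split; intros [X Hf]; exists X.
    + now rewrite inst_set_subst_up, <- IHf.
    + now rewrite IHf, <- inst_set_subst_up.
Qed.
End TermModel.

Definition models (M : structure) (T : form -> Prop) : Prop :=
  forall f, T f -> forall e r, sat M e r f.

(** A Henkin theory containing the negation of an unprovable [f] has a term model in which [f]
    fails. *)
Theorem completeness T f :
  (forall M, models M T -> forall e r, sat M e r f) -> provable T f.
Proof.
  intros Hf. apply NNPP. intros Hn.
  assert (Hc : consistent T [fNot f]).
  { intros Hbot. apply Hn. now apply prv_raa. }
  destruct (lindenbaum T _ Hc) as (H & HH & Hin).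
  assert (HM : models (term_model H) T).
  { intros g Hg e r.
    (* Every valuation is given by a substitution of terms, so validity of an open axiom reduces to
       derivability of its instances. *)
    replace e with (fun n => cls H (rep H (e n))).
    - apply (sat_term_model T H HH). apply (hk_closed _ _ HH []); [intros h []|].
      now apply prv_ax_subst.
    - extensionality n. apply cls_rep. }
  specialize (Hf _ HM (fun n => cls H (tvar n)) (fun X => X)).
  apply (sat_term_model T H HH) in Hf. rewrite subst_id in Hf.
  apply (hk_contra T H HH f Hf). apply Hin. now left.
Qed.

(** * Definability, induction and comprehension in a model *)

Lemma delta00_subst f : delta00 f -> forall s r, delta00 (subst s r f).
Proof.
  assert (Hsh : forall s t,
    subst_term (up_num s) (shift_term t) = shift_term (subst_term s t)).
  { intros s t. unfold shift_term. now rewrite !subst_term_comp. }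
  induction 1; intros s r; simpl; try (now constructor); rewrite Hsh.
  - now apply d_all.
  - now apply d_ex.
Qed.

Section Definability.
Variable M : structure.
Variable r : nat -> set M.
Implicit Types (e : nat -> num M).

(** Predicates on valuations stand in for formulas: definability is assembled by the closure rules
    below instead of writing de Bruijn formulas. Number parameters are entries of [e], set
    parameters entries of the fixed [r]. *)
Definition term_def (t : (nat -> num M) -> num M) : Prop :=
  exists u, forall e, eval M e u = t e.

Definition delta_def (A : (nat -> num M) -> Prop) : Prop :=
  exists f, delta00 f /\ forall e, sat M e r f <-> A e.

Lemma td_var n : term_def (fun e => e n).
Proof. now exists (tvar n). Qed.

Lemma td_zero : term_def (fun e => nzero M).
Proof. now exists tzero. Qed.

Lemma td_one : term_def (fun e => none M).
Proof. now exists tone. Qed.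

Lemma td_add t u : term_def t -> term_def u -> term_def (fun e => nadd M (t e) (u e)).
Proof.
  intros [t' Ht] [u' Hu]. exists (tadd t' u'). intros e; simpl. now rewrite Ht, Hu.
Qed.

Lemma td_mul t u : term_def t -> term_def u -> term_def (fun e => nmul M (t e) (u e)).
Proof.
  intros [t' Ht] [u' Hu]. exists (tmul t' u'). intros e; simpl. now rewrite Ht, Hu.
Qed.

Lemma dd_bot : delta_def (fun e => False).
Proof. exists fBot. split; [constructor|reflexivity]. Qed.

Lemma dd_eq t u : term_def t -> term_def u -> delta_def (fun e => t e = u e).
Proof.
  intros [t' Ht] [u' Hu]. exists (fEq t' u'). split; [constructor|].
  intros e; simpl. now rewrite Ht, Hu.
Qed.

Lemma dd_lt t u : term_def t -> term_def u -> delta_def (fun e => nlt M (t e) (u e)).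
Proof.
  intros [t' Ht] [u' Hu]. exists (fLt t' u'). split; [constructor|].
  intros e; simpl. now rewrite Ht, Hu.
Qed.

Lemma dd_mem t X : (exists k, r k = X) -> term_def t ->
  delta_def (fun e => nmem M (t e) X).
Proof.
  intros [k <-] [t' Ht]. exists (fIn t' k). split; [constructor|].
  intros e; simpl. now rewrite Ht.
Qed.

Lemma dd_imp A B : delta_def A -> delta_def B -> delta_def (fun e => A e -> B e).
Proof.
  intros [f [Df Hf]] [g [Dg Hg]]. exists (fImp f g). split; [now constructor|].
  intros e; simpl. now rewrite Hf, Hg.
Qed.

Lemma dd_and A B : delta_def A -> delta_def B -> delta_def (fun e => A e /\ B e).
Proof.
  intros [f [Df Hf]] [g [Dg Hg]]. exists (fAnd f g). split; [now constructor|].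
  intros e; simpl. now rewrite Hf, Hg.
Qed.

Lemma dd_or A B : delta_def A -> delta_def B -> delta_def (fun e => A e \/ B e).
Proof.
  intros [f [Df Hf]] [g [Dg Hg]]. exists (fOr f g). split; [now constructor|].
  intros e; simpl. now rewrite Hf, Hg.
Qed.

Lemma eval_shift_term e x t : eval M (scons x e) (shift_term t) = eval M e t.
Proof. unfold shift_term. now rewrite eval_subst. Qed.

Lemma dd_all t (Q : num M -> (nat -> num M) -> Prop) : term_def t ->
  delta_def (fun e => Q (e 0) (fun n => e (S n))) ->
  delta_def (fun e => forall x, nlt M x (t e) -> Q x e).
Proof.
  intros [t' Ht] [f [Df Hf]].
  exists (fAllN (fImp (fLt (tvar 0) (shift_term t')) f)). split; [now constructor|].
  intros e; cbn [sat]. split; intros H x Hx; apply (Hf (scons x e)); apply H;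
    revert Hx; simpl; now rewrite eval_shift_term, Ht.
Qed.

Lemma dd_ex t (Q : num M -> (nat -> num M) -> Prop) : term_def t ->
  delta_def (fun e => Q (e 0) (fun n => e (S n))) ->
  delta_def (fun e => exists x, nlt M x (t e) /\ Q x e).
Proof.
  intros [t' Ht] [f [Df Hf]].
  exists (fExN (fAnd (fLt (tvar 0) (shift_term t')) f)). split; [now constructor|].
  intros e; cbn [sat]. split; intros [x [Hx H]]; exists x; split;
    try (now apply (Hf (scons x e))); revert Hx; simpl; now rewrite eval_shift_term, Ht.
Qed.

Lemma dd_rename A (g : nat -> nat) : delta_def A -> delta_def (fun e => A (fun n => e (g n))).
Proof.
  intros [f [Df Hf]]. exists (subst (fun n => tvar (g n)) (fun X => X) f).
  split; [now apply delta00_subst|]. intros e. rewrite sat_subst. apply Hf.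
Qed.
End Definability.

Ltac definable :=
  unfold iff, not;
  repeat (cbv beta;
  first
  [ apply td_var | apply td_zero | apply td_one | apply td_add | apply td_mul
  | apply dd_bot | apply dd_and | apply dd_or
  | apply dd_eq | apply dd_lt
  | apply dd_mem;
    [first [exists 0; reflexivity | exists 1; reflexivity | exists 2; reflexivity
           | exists 3; reflexivity ]|]
  | apply dd_all | apply dd_imp | apply dd_ex ]).

Section Model.
Variable M : structure.
Hypothesis HM : models M RCA0.
Implicit Types (e : nat -> num M) (r : nat -> set M).

(** Entry 0 of the valuation is the existential witness, entry 1 the induction variable. *)
Lemma sigma1_induction r A : delta_def M r A -> forall e,
  (exists x, A (scons x (scons (nzero M) e))) ->
  (forall a, (exists x, A (scons x (scons a e))) ->
     exists x, A (scons x (scons (nadd M a (none M)) e))) ->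
  forall a, exists x, A (scons x (scons a e)).
Proof.
  intros [f [Df Hf]] e H0 HS a.
  pose proof (HM _ (ax_induction _ (sigma01_intro f Df)) e r) as H.
  cbn [sat] in H. unfold inst_num, inst_succ in H. rewrite sat_subst in H.
  assert (E : forall a e', e' = scons a e -> sat M e' r (fExN f) <->
    exists x, A (scons x (scons a e))).
  { intros b e' ->. simpl. split; intros [x Hx]; exists x; now apply Hf. }
  apply (E a _ eq_refl). apply H. split.
  - apply (E (nzero M)); [|exact H0]. extensionality n; now destruct n.
  - intros b Hb. apply (E b _ eq_refl) in Hb. apply sat_subst.
    apply (E (nadd M b (none M))); [|now apply HS]. extensionality n; now destruct n.
Qed.

Lemma delta_induction r A : delta_def M r A -> forall e,
  A (scons (nzero M) e) ->
  (forall a, A (scons a e) -> A (scons (nadd M a (none M)) e)) ->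
  forall a, A (scons a e).
Proof.
  intros HA e H0 HS a.
  (* A predicate with bounded quantifiers becomes Sigma01 through a dummy witness at entry 0, which
     renaming along [S] skips. *)
  destruct (sigma1_induction r _ (dd_rename M r A S HA) e) with (a := a) as [x Hx].
  - now exists (nzero M).
  - intros b [y Hb]. exists (nzero M). now apply HS.
  - exact Hx.
Qed.

Lemma delta1_comprehension r A B : delta_def M r A -> delta_def M r B -> forall e,
  (forall a, (exists x, A (scons x (scons a e))) <-> forall x, B (scons x (scons a e))) ->
  exists X, forall a, nmem M a X <-> exists x, A (scons x (scons a e)).
Proof.
  intros [f [Df Hf]] [g [Dg Hg]] e HAB.
  pose proof (HM _ (ax_comprehension _ _ (sigma01_intro f Df) (pi01_intro g Dg)) e r) as H.
  cbn [sat fIff] in H. destruct H as [X HX].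
  - intros a. fold (fIff (fExN f) (fAllN g)). cbn [sat fIff]. split.
    + intros [x Hx] y. apply Hg. apply HAB. exists x. now apply Hf.
    + intros Hx. destruct (proj2 (HAB a)) as [y Hy].
      * intros y. now apply Hg.
      * exists y. now apply Hf.
  - exists X. intros a. specialize (HX a). unfold shift_set in HX.
    fold (fIff (fIn (tvar 0) 0) (subst tvar S (fExN f))) in HX.
    cbn [sat fIff] in HX. rewrite sat_subst in HX. simpl in HX.
    split.
    + intros Ha. apply HX in Ha as [x Hx]. exists x. now apply Hf.
    + intros [x Hx]. apply HX. exists x. now apply Hf.
Qed.

Lemma delta_comprehension r A : delta_def M r A -> forall e,
  exists X, forall a, nmem M a X <-> A (scons a e).
Proof.
  intros HA e.
  destruct (delta1_comprehension r _ _ (dd_rename M r A S HA) (dd_rename M r A S HA) e)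
    as [X HX].
  - intros a. split; [now intros [x H] y|]. intros H. exists (nzero M). apply (H (nzero M)).
  - exists X. intros a. rewrite HX. split; [now intros [x H]|]. intros H.
    now exists (nzero M).
Qed.
End Model.

(** * Arithmetic in a model *)

Declare Scope num_scope.
Notation "0" := (nzero _) : num_scope.
Notation "1" := (none _) : num_scope.
Notation "a + b" := (nadd _ a b) : num_scope.
Notation "a * b" := (nmul _ a b) : num_scope.
Notation "a < b" := (nlt _ a b) : num_scope.

Section Arithmetic.
Local Open Scope num_scope.
Variable M : structure.
Hypothesis HM : models M RCA0.
(* Needed only to have a valuation of the set variables. *)
Variable X0 : set M.
Implicit Types (a b c d i j k m n u v w x y z : num M).

Lemma induct r (P : num M -> (nat -> num M) -> Prop) p :
  delta_def M r (fun e => P (e O) (fun q => e (S q))) ->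
  P 0 p -> (forall a, P a p -> P (a + 1) p) -> forall a, P a p.
Proof. intros HP. exact (delta_induction M HM r _ HP p). Qed.

Lemma sigma_induct r (P : num M -> num M -> (nat -> num M) -> Prop) p :
  delta_def M r (fun e => P (e 1%nat) (e O) (fun q => e (S (S q)))) ->
  (exists x, P 0 x p) ->
  (forall a, (exists x, P a x p) -> exists x, P (a + 1) x p) ->
  forall a, exists x, P a x p.
Proof. intros HP. exact (sigma1_induction M HM r _ HP p). Qed.

Let r0 : nat -> set M := fun _ => X0.
Let env1 a : nat -> num M := fun _ => a.
Let env2 a b : nat -> num M := scons a (fun _ => b).

Lemma succ_neq_0 a : a + 1 <> 0.
Proof. exact (HM _ ax_succ_ne0 (env1 a) r0). Qed.

Lemma succ_inj a b : a + 1 = b + 1 -> a = b.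
Proof. exact (HM _ ax_succ_inj (env2 a b) r0). Qed.

Lemma nadd_0_r a : a + 0 = a.
Proof. exact (HM _ ax_add0 (env1 a) r0). Qed.

Lemma nadd_succ_r a b : a + (b + 1) = (a + b) + 1.
Proof. exact (HM _ ax_addS (env2 a b) r0). Qed.

Lemma nmul_0_r a : a * 0 = 0.
Proof. exact (HM _ ax_mul0 (env1 a) r0). Qed.

Lemma nmul_succ_r a b : a * (b + 1) = a * b + a.
Proof. exact (HM _ ax_mulS (env2 a b) r0). Qed.

Lemma nlt_0_r a : ~ a < 0.
Proof. exact (HM _ ax_lt0 (env1 a) r0). Qed.

Lemma nlt_succ_r a b : a < b + 1 <-> a < b \/ a = b.
Proof. exact (HM _ ax_ltS (env2 a b) r0). Qed.

Ltac induction_on P p := apply (induct r0 P p); [definable|cbn|cbn; intros].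

Lemma nadd_0_l a : 0 + a = a.
Proof.
  revert a. induction_on (fun a (_ : nat -> num M) => 0 + a = a) (env1 0).
  - apply nadd_0_r.
  - now rewrite nadd_succ_r, H.
Qed.

Lemma zero_or_succ a : a = 0 \/ exists b, a = b + 1.
Proof.
  destruct (sigma_induct r0 (fun a x _ => a = 0 \/ a = x + 1) (env1 0)) with (a := a)
    as [x [Hx|Hx]].
  - definable.
  - exists 0. now left.
  - intros b _. exists b. now right.
  - now left.
  - right. now exists x.
Qed.

(* The constant 1 is not by definition the successor of 0. *)
Lemma nadd_0_1 : 0 + 1 = 1 :> num M.
Proof. apply nadd_0_l. Qed.

Lemma nadd_succ_l a b : (a + 1) + b = (a + b) + 1.
Proof.
  revert b. induction_on (fun b p => (p O + 1) + b = (p O + b) + 1) (env1 a).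
  - now rewrite !nadd_0_r.
  - now rewrite !nadd_succ_r, H.
Qed.

Lemma nadd_comm a b : a + b = b + a.
Proof.
  revert b. induction_on (fun b p => p O + b = b + p O) (env1 a).
  - now rewrite nadd_0_r, nadd_0_l.
  - now rewrite nadd_succ_r, nadd_succ_l, H.
Qed.

Lemma nadd_assoc a b c : a + (b + c) = (a + b) + c.
Proof.
  revert c. induction_on (fun c p => p O + (p 1%nat + c) = (p O + p 1%nat) + c) (env2 a b).
  - now rewrite !nadd_0_r.
  - now rewrite !nadd_succ_r, H.
Qed.

Lemma nmul_0_l a : 0 * a = 0.
Proof.
  revert a. induction_on (fun a (_ : nat -> num M) => 0 * a = 0) (env1 0).
  - apply nmul_0_r.
  - now rewrite nmul_succ_r, H, nadd_0_r.
Qed.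

Lemma nmul_succ_l a b : (a + 1) * b = a * b + b.
Proof.
  revert b. induction_on (fun b p => (p O + 1) * b = p O * b + b) (env1 a).
  - now rewrite !nmul_0_r, nadd_0_r.
  - rewrite !nmul_succ_r, H, !nadd_succ_r. f_equal.
    rewrite <- !nadd_assoc. f_equal. apply nadd_comm.
Qed.

Lemma nmul_comm a b : a * b = b * a.
Proof.
  revert b. induction_on (fun b p => p O * b = b * p O) (env1 a).
  - now rewrite nmul_0_r, nmul_0_l.
  - now rewrite nmul_succ_r, nmul_succ_l, H.
Qed.

Lemma nmul_add_distr_r a b c : (a + b) * c = a * c + b * c.
Proof.
  revert c.
  induction_on (fun c p => (p O + p 1%nat) * c = p O * c + p 1%nat * c) (env2 a b).
  - now rewrite !nmul_0_r, nadd_0_r.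
  - rewrite !nmul_succ_r, H, <- !nadd_assoc. f_equal.
    rewrite !nadd_assoc. f_equal. apply nadd_comm.
Qed.

Lemma nmul_assoc a b c : a * (b * c) = (a * b) * c.
Proof.
  revert c.
  induction_on (fun c p => p O * (p 1%nat * c) = (p O * p 1%nat) * c) (env2 a b).
  - now rewrite !nmul_0_r.
  - rewrite !nmul_succ_r, nmul_comm, nmul_add_distr_r, (nmul_comm (b * _)), H.
    f_equal. apply nmul_comm.
Qed.

Lemma nmul_1_l a : 1 * a = a.
Proof. rewrite <- nadd_0_1. now rewrite nmul_succ_l, nmul_0_l, nadd_0_l. Qed.

Lemma num_semi_ring : semi_ring_theory (nzero M) (none M) (nadd M) (nmul M) eq.
Proof.
  constructor; intros.
  - apply nadd_0_l.
  - apply nadd_comm.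
  - apply nadd_assoc.
  - apply nmul_1_l.
  - apply nmul_0_l.
  - apply nmul_comm.
  - apply nmul_assoc.
  - apply nmul_add_distr_r.
Qed.

Add Ring num_ring : num_semi_ring.

Lemma nadd_cancel_r a b c : a + c = b + c -> a = b.
Proof.
  revert c. induction_on (fun c p => p O + c = p 1%nat + c -> p O = p 1%nat) (env2 a b).
  - now rewrite !nadd_0_r.
  - apply H, succ_inj. now rewrite <- !nadd_succ_r.
Qed.

Lemma nlt_add_succ a c : a < a + c + 1.
Proof.
  revert c. induction_on (fun c p => p O < p O + c + 1) (env1 a).
  - apply nlt_succ_r. right. ring.
  - apply nlt_succ_r. left. now rewrite nadd_succ_r.
Qed.

(** Turns inequalities into equations that [ring] can settle. The difference is found by Sigma01
    induction on [b], starting from 0 at [b = a + 1]. *)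
Lemma nlt_exists a b : a < b <-> exists c, b = a + c + 1.
Proof.
  split; [|intros [c ->]; apply nlt_add_succ].
  destruct (sigma_induct r0 (fun b c p => p O < b -> b = p O + c + 1) (env1 a))
    with (a := b) as [c Hc].
  - definable.
  - exists 0. intros H. now apply nlt_0_r in H.
  - cbn. intros b' [c Hc]. destruct (classic (a < b')) as [H|H].
    + exists (c + 1). intros _. rewrite (Hc H) at 1. ring.
    + exists 0. intros H'. apply nlt_succ_r in H' as [H'|<-]; [contradiction|]. ring.
  - cbn in Hc. eauto.
Qed.

Lemma nlt_irrefl a : ~ a < a.
Proof.
  intros H. apply nlt_exists in H as [c Hc]. apply (succ_neq_0 c).
  apply nadd_cancel_r with a. rewrite nadd_0_l. rewrite Hc at 2. ring.
Qed.

Lemma nlt_trans a b c : a < b -> b < c -> a < c.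
Proof.
  rewrite !nlt_exists. intros [d ->] [d' ->]. exists (d + d' + 1). ring.
Qed.

Lemma nlt_0_succ a : 0 < a + 1.
Proof. apply nlt_exists. exists a. ring. Qed.

Lemma nlt_trichotomy a b : a < b \/ a = b \/ b < a.
Proof.
  revert b. induction_on (fun b p => p O < b \/ p O = b \/ b < p O) (env1 a).
  - destruct (zero_or_succ a) as [->|[c ->]]; [auto|right; right; apply nlt_0_succ].
  - destruct H as [H|[->|H]].
    + left. apply nlt_succ_r. now left.
    + left. apply nlt_succ_r. now right.
    + right. apply nlt_exists in H as [c ->].
      destruct (zero_or_succ c) as [->|[d ->]].
      * left. ring.
      * right. apply nlt_exists. exists d. ring.
Qed.

(* [a < b + 1] serves as [a <= b]. *)
Lemma nlt_succ_exists a b : a < b + 1 <-> exists c, b = a + c.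
Proof.
  rewrite nlt_exists. split; intros [c Hc]; exists c.
  - now apply succ_inj.
  - now rewrite Hc.
Qed.

Lemma nlt_succ_or a b : a < b + 1 \/ b < a.
Proof.
  rewrite nlt_succ_r. destruct (nlt_trichotomy a b) as [H|[H|H]]; auto.
Qed.

Lemma nle_lt_trans a b c : a < b + 1 -> b < c -> a < c.
Proof.
  rewrite nlt_succ_r. intros [H| ->] Hb; [now apply nlt_trans with b|assumption].
Qed.

Lemma nlt_le_trans a b c : a < b -> b < c + 1 -> a < c.
Proof.
  rewrite nlt_succ_r. intros H [Hb|<-]; [now apply nlt_trans with b|assumption].
Qed.

Lemma nle_trans a b c : a < b + 1 -> b < c + 1 -> a < c + 1.
Proof.
  intros H1 H2. rewrite nlt_succ_r in H2. destruct H2 as [H2|<-]; [|assumption].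
  apply nlt_succ_r. left. now apply nle_lt_trans with b.
Qed.

Lemma nle_antisym a b : a < b + 1 -> b < a + 1 -> a = b.
Proof.
  rewrite !nlt_succ_r. intros [H|H] [H'|H']; auto. exfalso.
  apply (nlt_irrefl a). now apply nlt_trans with b.
Qed.

Lemma nle_refl a : a < a + 1.
Proof. apply nlt_succ_r. now right. Qed.

Lemma strong_induct r (P : num M -> (nat -> num M) -> Prop) p :
  delta_def M r (fun e => P (e O) (fun q => e (S q))) ->
  (forall a, (forall b, b < a -> P b p) -> P a p) -> forall a, P a p.
Proof.
  intros HP Hstep a. apply Hstep. revert a.
  apply (induct r (fun a p => forall b, b < a -> P b p) p).
  - apply (dd_all M r (fun e => e O) (fun b e => P b (fun q => e (S q))));
      [apply td_var|].
    (* The bound number stays at entry 0; the skipped entry 1 holds its bound [a]. *)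
    exact (dd_rename M r _ (fun q => match q with O => O | S q => S (S q) end) HP).
  - intros b Hb. now apply nlt_0_r in Hb.
  - intros a IH b Hb. apply nlt_succ_r in Hb as [Hb| ->]; auto.
Qed.

(** * Divisibility and codes of finite sets *)

Definition dvd a b : Prop := exists k, a * k = b.

Lemma dvd_mul_r a b c : dvd a b -> dvd a (b * c).
Proof. intros [k <-]. exists (k * c). ring. Qed.

Lemma dvd_mul_l a b c : dvd a b -> dvd a (c * b).
Proof. intros [k <-]. exists (k * c). ring. Qed.

(** Without subtraction the two quotients are compared: either their difference is the quotient of
    [b], or [b] must be 0. *)
Lemma dvd_add_cancel v a b : dvd v (a + b) -> dvd v a -> dvd v b.
Proof.
  intros [k Hk] [l <-]. destruct (nlt_succ_or l k) as [H|H].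
  - apply nlt_succ_exists in H as [d ->]. exists d.
    apply nadd_cancel_r with (v * l). rewrite (nadd_comm b), <- Hk. ring.
  - apply nlt_exists in H as [d ->]. exists 0.
    apply nadd_cancel_r with (v * k). rewrite nmul_0_r, nadd_0_l.
    destruct (zero_or_succ b) as [->|[b' ->]]; [ring|exfalso].
    apply (succ_neq_0 (v * d + v + b')). apply nadd_cancel_r with (v * k).
    rewrite nadd_0_l. transitivity (v * (k + d + 1) + (b' + 1)); [ring|now symmetry].
Qed.

(** A nonzero divisor bounds the quotient by [b], so divisibility becomes definable with bounded
    quantifiers. *)
Lemma dvd_bounded a b : a <> 0 -> dvd a b <-> exists k, k < b + 1 /\ a * k = b.
Proof.
  intros Ha. split; [|intros [k [_ Hk]]; now exists k].
  intros [k <-]. exists k. split; [|reflexivity].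
  destruct (zero_or_succ a) as [->|[a' ->]]; [contradiction|].
  apply nlt_succ_exists. exists (a' * k). ring.
Qed.

Lemma nmul_neq_0 a b : a <> 0 -> b <> 0 -> a * b <> 0.
Proof.
  intros Ha Hb. destruct (zero_or_succ a) as [->|[a' ->]]; [contradiction|].
  destruct (zero_or_succ b) as [->|[b' ->]]; [contradiction|].
  replace ((a' + 1) * (b' + 1)) with (a' * b' + a' + b' + 1) by ring.
  apply succ_neq_0.
Qed.

(** A substitute for the factorial of [n], obtained by Sigma01 induction without defining the
    factorial function. *)
Lemma common_multiple n :
  exists m, m <> 0 /\ forall d, d < n + 1 -> d <> 0 -> dvd d m.
Proof.
  destruct (sigma_induct r0 (fun n m _ => m <> 0 /\ forall d, d < n + 1 -> d <> 0 ->
    exists k, k < m + 1 /\ d * k = m) (env1 0)) with (a := n) as [m [Hm Hd]].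
  - definable.
  - exists 1. split; [rewrite <- nadd_0_1; apply succ_neq_0|].
    intros d Hd Hd0. apply nlt_succ_r in Hd as [Hd|Hd]; [now apply nlt_0_r in Hd|].
    contradiction.
  - intros n' [m [Hm Hd]]. exists (m * (n' + 1)).
    split; [now apply nmul_neq_0, succ_neq_0|].
    intros d Hdn Hd0. apply dvd_bounded; [assumption|].
    apply nlt_succ_r in Hdn as [Hdn| ->].
    + apply dvd_mul_r. apply dvd_bounded; auto.
    + exists m. ring.
  - exists m. split; [assumption|]. intros d Hdn Hd0. apply dvd_bounded; auto.
Qed.

(** [(c, m)] codes the set of the [i] such that [1 + (i + 1) m] divides [c]. *)
Definition modulus m i : num M := (i + 1) * m + 1.
Definition in_code c m i : Prop := exists k, k < c + 1 /\ modulus m i * k = c.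

Lemma in_code_dvd c m i : in_code c m i <-> dvd (modulus m i) c.
Proof. symmetry. apply dvd_bounded, succ_neq_0. Qed.

Lemma in_code_1 m i : m <> 0 -> ~ in_code 1 m i.
Proof.
  intros Hm [k [Hk Hik]]. destruct (zero_or_succ m) as [->|[m' ->]]; [contradiction|].
  destruct (zero_or_succ k) as [->|[k' ->]].
  - rewrite nmul_0_r in Hik. apply (succ_neq_0 0). now rewrite nadd_0_1.
  - apply (succ_neq_0 (((i + 1) * m' + i) * (k' + 1) + k' * (1 + 1))).
    apply nadd_cancel_r with 1.
    transitivity (modulus (m' + 1) i * (k' + 1)); [unfold modulus; ring|].
    rewrite Hik. ring.
Qed.

(** [v] is prime to [m], hence to its divisor [d]. With m = d k, the identity c v = (c d)(k t) + c
    gives the conclusion without subtraction. *)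
Lemma dvd_modulus_cancel c m v t d : m <> 0 -> dvd d m ->
  v = t * m + 1 -> dvd v (c * d) -> dvd v c.
Proof.
  intros Hm [k Hk] Hv Hd.
  apply dvd_add_cancel with (c * d * (k * t)); [|now apply dvd_mul_r].
  exists c. rewrite Hv, <- Hk. ring.
Qed.

(* Two moduli with indices differing by [d] generate [d], a divisor of [m], and
   each of them is prime to [m]. *)
Lemma in_code_insert c m n i j :
  m <> 0 -> (forall d, d < n + 1 -> d <> 0 -> dvd d m) ->
  i < n + 1 -> j < n + 1 ->
  in_code (c * modulus m i) m j <-> in_code c m j \/ j = i.
Proof.
  intros Hm Hdiv Hi Hj. rewrite !in_code_dvd. split.
  - intros Hd. destruct (nlt_trichotomy j i) as [H|[H|H]]; [left|now right|left].
    + apply nlt_exists in H as [d ->].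
      apply (dvd_modulus_cancel c m _ (j + 1) (d + 1) Hm); [|reflexivity|].
      * apply Hdiv; [|apply succ_neq_0]. apply nle_trans with (2 := Hi).
        apply nlt_succ_exists. exists j. ring.
      (* With i = j + d + 1, (j + 1)(1 + (i + 1) m) + (d + 1) = (i + 1)(1 + (j + 1) m). *)
      * apply dvd_add_cancel with (c * modulus m (j + d + 1) * (j + 1));
          [|now apply dvd_mul_r].
        exists (c * (j + d + 1 + 1)). unfold modulus. ring.
    + apply nlt_exists in H as [d ->].
      apply (dvd_modulus_cancel c m _ (i + d + 1 + 1) (d + 1) Hm); [|reflexivity|].
      * apply Hdiv; [|apply succ_neq_0]. apply nle_trans with (2 := Hj).
        apply nlt_succ_exists. exists i. ring.
      * apply dvd_add_cancel with (c * modulus m (i + d + 1) * (i + 1)).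
        -- replace (c * modulus m (i + d + 1) * (i + 1) + c * (d + 1))
             with (c * modulus m i * (i + d + 1 + 1)) by (unfold modulus; ring).
           now apply dvd_mul_r.
        -- exists (c * (i + 1)). ring.
  - intros [Hd| ->]; [now apply dvd_mul_r|]. apply dvd_mul_l. exists 1. ring.
Qed.

(** * Course-of-values recursion *)

Section Recursion.
Variable r : nat -> set M.
Variable Phi : num M -> (num M -> Prop) -> Prop.
Hypothesis Phi_ext : forall n (Y Y' : num M -> Prop),
  (forall w, w < n -> Y w <-> Y' w) -> Phi n Y -> Phi n Y'.
(** Definability is asked for coded sets: finite approximations then enter bounded formulas as pairs
    of numbers. *)
Hypothesis Phi_def :
  delta_def M r (fun e => Phi (e O) (in_code (e 1%nat) (e 2%nat))).

Definition correct n c m : Prop :=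
  forall z, z < n -> (in_code c m z <-> Phi z (in_code c m)).

Lemma dd_Phi (i j k : nat) :
  delta_def M r (fun e => Phi (e i) (in_code (e j) (e k))).
Proof.
  exact (dd_rename M r _ (fun q => match q with O => i | 1%nat => j | _ => k end) Phi_def).
Qed.

Lemma dd_correct t (i j : nat) : term_def M t ->
  delta_def M r (fun e => correct (t e) (e i) (e j)).
Proof.
  intros Ht. unfold correct, iff.
  apply (dd_all M r t (fun z e => (in_code (e i) (e j) z -> Phi z (in_code (e i) (e j)))
    /\ (Phi z (in_code (e i) (e j)) -> in_code (e i) (e j) z)) Ht).
  apply dd_and; apply dd_imp; (apply (dd_Phi 0 (S i) (S j)) ||
    (unfold in_code, modulus; definable)).
Qed.

Lemma correct_unique n c m n' c' m' : correct n c m -> correct n' c' m' ->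
  forall z, z < n -> z < n' -> in_code c m z <-> in_code c' m' z.
Proof.
  intros H H'.
  apply (strong_induct r0 (fun z p => z < p O -> z < p 1%nat ->
    in_code (p 2%nat) (p 3%nat) z <-> in_code (p 4%nat) (p 5%nat) z)
    (scons n (scons n' (scons c (scons m (scons c' (scons m' (env1 0)))))))).
  - unfold in_code, modulus. definable.
  - cbn. intros z IH Hn Hn'. rewrite (H z Hn), (H' z Hn').
    assert (E : forall w, w < z -> in_code c m w <-> in_code c' m' w).
    { intros w Hw. apply IH; [assumption|now apply nlt_trans with z..]. }
    split; apply Phi_ext; [assumption|]. intros w Hw. symmetry. auto.
Qed.

(** One [m] serves for all numbers up to [n], while [c] grows by Sigma01 induction: [modulus m z] is
    multiplied in exactly when [Phi] puts [z] into the set. The second conjunct ensures that no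
    undecided number is a member beforehand. *)
Lemma correct_exists n : exists c m, correct n c m.
Proof.
  destruct (common_multiple n) as [m [Hm Hdiv]].
  destruct (sigma_induct r (fun z c p => z < p O + 1 -> correct z c (p 1%nat) /\
      forall w, w < p O + 1 -> in_code c (p 1%nat) w -> w < z) (env2 n m))
    with (a := n) as [c Hc].
  - apply dd_imp; [definable|]. apply dd_and.
    + apply (dd_correct (fun e => e 1%nat) 0 3). definable.
    + unfold in_code, modulus. definable.
  (* The code 1 represents the empty set. *)
  - exists 1. intros _. split.
    + intros z Hz. now apply nlt_0_r in Hz.
    + intros w _ Hw. now apply in_code_1 in Hw.
  - cbn. intros z [c Hc]. destruct (nlt_succ_or (z + 1) n) as [Hz|Hz].
    2: { exists 0. intros Hz'. exfalso. apply (nlt_irrefl n).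
         now apply nlt_le_trans with (z + 1). }
    assert (Hzn : z < n + 1).
    { apply nlt_trans with (2 := Hz). apply nle_refl. }
    destruct (Hc Hzn) as [Hcor Hbd].
    assert (Hlt : forall w, w < z -> w < n + 1).
    { intros w Hw. now apply nlt_trans with z. }
    destruct (classic (Phi z (in_code c m))) as [HPhi|HPhi].
    + exists (c * modulus m z). intros _.
      assert (Hin : forall w, w < n + 1 ->
        in_code (c * modulus m z) m w <-> in_code c m w \/ w = z).
      { intros w Hw. now apply in_code_insert with n. }
      assert (Hext : forall w, w < z ->
        in_code (c * modulus m z) m w <-> in_code c m w).
      { intros w Hw. rewrite Hin by auto. split; [|auto]. intros [H| ->]; [assumption|].
        now apply nlt_irrefl in Hw. }
      split.
      * intros w Hw. apply nlt_succ_r in Hw as [Hw| ->].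
        -- rewrite Hext by assumption. rewrite (Hcor w Hw).
           split; apply Phi_ext; intros v Hv; [symmetry|];
             apply Hext; now apply nlt_trans with w.
        -- split; [intros _|intros _; apply Hin; auto].
           revert HPhi. apply Phi_ext. intros v Hv. symmetry. auto.
      * intros w Hw Hwin. apply nlt_succ_r.
        apply Hin in Hwin as [Hwin|Hwin]; auto.
    + exists c. intros _. split.
      * intros w Hw. apply nlt_succ_r in Hw as [Hw| ->]; [auto|].
        split; [|contradiction]. intros Hwin.
        apply Hbd in Hwin; [|assumption]. now apply nlt_irrefl in Hwin.
      * intros w Hw Hwin. apply nlt_succ_r. left. auto.
  - exists c, m. apply Hc. apply nle_refl.
Qed.

(** Membership of [n] can be read off from some correct approximation or from all of them, because
    these exist and agree; so it is Delta01. *)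
Lemma recursion : exists X, forall n, nmem M n X <-> Phi n (fun w => nmem M w X).
Proof.
  (* A single unbounded number bounds both [c] and [m], as Sigma01 and Pi01 formulas have just one
     unbounded quantifier. *)
  destruct (delta1_comprehension M HM r
    (fun e => exists c, c < e O /\ exists m, m < e O /\
       correct (e 1%nat + 1) c m /\ in_code c m (e 1%nat))
    (fun e => forall c, c < e O -> forall m, m < e O ->
       correct (e 1%nat + 1) c m -> in_code c m (e 1%nat))) with (e := env1 0)
    as [X HX].
  - apply (dd_ex M r (fun e => e O) (fun c e => exists m, m < e O /\
       correct (e 1%nat + 1) c m /\ in_code c m (e 1%nat))); [definable|].
    apply (dd_ex M r (fun e => e 1%nat) (fun m e =>
       correct (e 2%nat + 1) (e O) m /\ in_code (e O) m (e 2%nat))); [definable|].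
    apply dd_and; [apply (dd_correct (fun e => e 3%nat + 1) 1 0)|
      unfold in_code, modulus]; definable.
  - apply (dd_all M r (fun e => e O) (fun c e => forall m, m < e O ->
       correct (e 1%nat + 1) c m -> in_code c m (e 1%nat))); [definable|].
    apply (dd_all M r (fun e => e 1%nat) (fun m e =>
       correct (e 2%nat + 1) (e O) m -> in_code (e O) m (e 2%nat))); [definable|].
    apply dd_imp; [apply (dd_correct (fun e => e 3%nat + 1) 1 0)|
      unfold in_code, modulus]; definable.
  - cbn. intros n. split.
    + intros [N (c & _ & m & _ & Hcor & Hn)] N' c' _ m' _ Hcor'.
      apply (correct_unique _ _ _ _ _ _ Hcor Hcor'); auto using nle_refl.
    + intros H. destruct (correct_exists (n + 1)) as (c & m & Hcor).
      exists (c + m + 1).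
      assert (c < c + m + 1 /\ m < c + m + 1) as [Hc Hm].
      { split; apply nlt_succ_exists; [exists m|exists c]; ring. }
      exists c. split; [assumption|]. exists m. eauto.
  (* On its domain every correct approximation agrees with [X], so the recursion equation carries
     over from it. *)
  - assert (HX' : forall n c m, correct (n + 1) c m ->
      forall w, w < n + 1 -> nmem M w X <-> in_code c m w).
    { intros n c m Hcor w Hw. rewrite HX. cbn. split.
      - intros [N (c' & _ & m' & _ & Hcor' & Hn)].
        apply (correct_unique _ _ _ _ _ _ Hcor' Hcor); auto using nle_refl.
      - intros Hwin. exists (c + m + 1).
        exists c. split; [apply nlt_succ_exists; now exists m|].
        exists m. split; [apply nlt_succ_exists; exists c; ring|].
        split; [|assumption]. intros z Hz. apply Hcor.
        apply nlt_succ_r in Hz as [Hz| ->]; [|assumption]. now apply nlt_trans with w. }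
    exists X. intros n. destruct (correct_exists (n + 1)) as (c & m & Hcor).
    rewrite (HX' _ _ _ Hcor n (nle_refl n)), (Hcor n (nle_refl n)).
    split; apply Phi_ext; intros w Hw; [symmetry|]; apply (HX' _ _ _ Hcor);
      apply nlt_succ_r; now left.
Qed.
End Recursion.

(** * Interval orders in a model *)

Definition pair i j : num M := (i + j) * (i + j) + i.

Lemma sum_le_pair i j : i + j < pair i j + 1.
Proof.
  apply nlt_succ_exists. destruct (zero_or_succ (i + j)) as [H|[d H]].
  - exists (pair i j). rewrite H. ring.
  - exists (d * (i + j) + i). unfold pair.
    transitivity ((d + 1) * (i + j) + i); [now rewrite <- H|ring].
Qed.

Lemma le_pair_l i j : i < pair i j + 1.
Proof.
  apply nle_trans with (2 := sum_le_pair i j). apply nlt_succ_exists. now exists j.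
Qed.

Lemma le_pair_r i j : j < pair i j + 1.
Proof.
  apply nle_trans with (2 := sum_le_pair i j). apply nlt_succ_exists. exists i. ring.
Qed.

(** Makes recursion on the second component, with the first fixed, a recursion on codes. *)
Lemma pair_lt_r i j k : j < k -> pair i j < pair i k.
Proof.
  intros H. apply nlt_exists in H as [d ->]. apply nlt_exists.
  exists ((d + 1) * (i + j) + (i + j + d) * (d + 1) + d). unfold pair. ring.
Qed.

(** Codes of pairs with sum s lie between s^2 and s^2 + s, hence below (s + 1)^2; injectivity will
    follow. *)
Lemma pair_lt_of_sum_lt i j i' j' : i + j < i' + j' -> pair i j < pair i' j'.
Proof.
  intros H. apply nlt_exists in H as [d H]. apply nlt_exists.
  exists (j + i + j + d * (d + 1 + 1) + d * (i + j + i + j) + i').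
  unfold pair. rewrite H. ring.
Qed.

Lemma pair_inj i j i' j' : pair i j = pair i' j' -> i = i' /\ j = j'.
Proof.
  intros H. assert (Hs : i + j = i' + j').
  { destruct (nlt_trichotomy (i + j) (i' + j')) as [Hlt|[Hs|Hlt]]; [|assumption|];
      apply pair_lt_of_sum_lt in Hlt; rewrite H in Hlt; now apply nlt_irrefl in Hlt. }
  unfold pair in H. rewrite Hs in H.
  assert (Hi : i = i').
  { apply nadd_cancel_r with ((i' + j') * (i' + j')).
    rewrite (nadd_comm i), H. apply nadd_comm. }
  split; [assumption|]. subst i'. apply nadd_cancel_r with i.
  rewrite (nadd_comm j), Hs. apply nadd_comm.
Qed.

(** * Order notions in a model and the easy implication *)

Definition rel_in (Q : set M) x y : Prop := nmem M (pair x y) Q.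
Definition lt_in (Q : set M) x y : Prop := rel_in Q x y /\ ~ x = y.

(** This and the following notions mirror the formulas literally, down to the nesting of
    conjunctions and relativized quantifiers, so that satisfaction converts to them by
    computation. *)
Definition sem_sub_prod (Q A B : set M) : Prop :=
  forall n, nmem M n Q -> exists x, nmem M x A /\ exists y, nmem M y B /\ n = pair x y.

Definition sem_partial_order (P R : set M) : Prop :=
  sem_sub_prod R P P
  /\ (forall x, nmem M x P -> rel_in R x x)
  /\ (forall x, nmem M x P -> forall y, nmem M y P -> forall z, nmem M z P ->
        rel_in R x y /\ rel_in R y z -> rel_in R x z)
  /\ (forall x, nmem M x P -> forall y, nmem M y P ->
        rel_in R x y /\ rel_in R y x -> x = y).

Definition sem_linear_order (L S : set M) : Prop :=
  sem_partial_order L S /\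
  forall x, nmem M x L -> forall y, nmem M y L -> rel_in S x y \/ rel_in S y x.

Definition sem_representation (P R L S F : set M) : Prop :=
  sem_linear_order L S
  /\ sem_sub_prod F P L
  /\ (forall p, nmem M p P ->
        (exists x, nmem M x L /\ rel_in F p x) /\
        forall x, nmem M x L -> forall y, nmem M y L -> forall z, nmem M z L ->
          rel_in F p x /\ rel_in F p y /\ lt_in S x z /\ lt_in S z y -> rel_in F p z)
  /\ (forall p, nmem M p P -> forall q, nmem M q P ->
        (lt_in R p q <->
         forall x, nmem M x L -> forall y, nmem M y L ->
           rel_in F p x /\ rel_in F q y -> lt_in S x y)).

Definition sem_no_two_plus_two (P R : set M) : Prop :=
  forall p0, nmem M p0 P -> forall q0, nmem M q0 P ->
  forall p1, nmem M p1 P -> forall q1, nmem M q1 P ->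
  lt_in R p0 q0 /\ lt_in R p1 q1 -> rel_in R p0 q1 \/ rel_in R p1 q0.

Lemma lt_in_trans (P R : set M) : sem_partial_order P R ->
  forall x y z, nmem M x P -> nmem M y P -> nmem M z P ->
  lt_in R x y -> lt_in R y z -> lt_in R x z.
Proof.
  intros (_ & _ & Htr & Has) x y z Hx Hy Hz [Hxy Nxy] [Hyz Nyz]. split.
  - now apply Htr with y.
  - intros ->. apply Nxy. now apply Has.
Qed.

Lemma lt_in_or_rel_in (L S : set M) : sem_linear_order L S ->
  forall x y, nmem M x L -> nmem M y L -> lt_in S x y \/ rel_in S y x.
Proof.
  intros [(_ & Hrefl & _) Htot] x y Hx Hy.
  destruct (Htot x Hx y Hy) as [H|H]; [|now right].
  destruct (classic (x = y)) as [->|N]; [right; auto|left; now split].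
Qed.

Lemma rel_lt_in_trans (L S : set M) : sem_linear_order L S ->
  forall x y z, nmem M x L -> nmem M y L -> nmem M z L ->
  rel_in S x y -> lt_in S y z -> lt_in S x z.
Proof.
  intros [HPO _] x y z Hx Hy Hz Hxy Hyz.
  destruct (classic (x = y)) as [->|N]; [assumption|].
  now apply (lt_in_trans L S HPO) with y.
Qed.

Lemma lt_in_irrefl (S : set M) x : ~ lt_in S x x.
Proof. now intros [_ N]. Qed.

Lemma representation_no_two_plus_two (P R L S F : set M) : sem_partial_order P R ->
  sem_representation P R L S F -> sem_no_two_plus_two P R.
Proof.
  intros HP (HL & _ & _ & Hrep) p0 Hp0 q0 Hq0 p1 Hp1 q1 Hq1 [H0 H1].
  assert (Hcross : forall p q, nmem M p P -> nmem M q P -> ~ rel_in R p q ->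
    exists x y, (nmem M x L /\ nmem M y L) /\ rel_in F p x /\ rel_in F q y /\ rel_in S y x).
  { intros p q Hp Hq N. apply NNPP. intros Hno. apply N.
    assert (Hlt : lt_in R p q); [|apply Hlt]. apply (Hrep p Hp q Hq).
    intros x Hx y Hy [Hpx Hqy].
    destruct (lt_in_or_rel_in L S HL x y Hx Hy) as [H|H]; [assumption|].
    exfalso. apply Hno. now exists x, y. }
  apply NNPP. intros N. apply not_or_and in N as [N0 N1].
  destruct (Hcross p0 q1 Hp0 Hq1 N0) as (x0 & y1 & [Hx0 Hy1] & Fx0 & Fy1 & Hle1).
  destruct (Hcross p1 q0 Hp1 Hq0 N1) as (x1 & y0 & [Hx1 Hy0] & Fx1 & Fy0 & Hle0).
  (* This closes the cycle x0 < y0 <= x1 < y1 <= x0. *)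
  pose proof (proj1 (Hrep p0 Hp0 q0 Hq0) H0 x0 Hx0 y0 Hy0 (conj Fx0 Fy0)) as A0.
  pose proof (proj1 (Hrep p1 Hp1 q1 Hq1) H1 x1 Hx1 y1 Hy1 (conj Fx1 Fy1)) as A1.
  apply (lt_in_irrefl S y1).
  apply (rel_lt_in_trans L S HL) with x0; auto.
  apply (lt_in_trans L S (proj1 HL)) with y0; auto.
  now apply (rel_lt_in_trans L S HL) with x1.
Qed.

(** * Construction of a representation by cuts *)

Section Representation.
Variables P R : set M.
Hypothesis HP : sem_partial_order P R.
Hypothesis Hfree : sem_no_two_plus_two P R.

Local Notation "x ≺ y" := (lt_in R x y) (at level 70).

Lemma lt_in_field x y : x ≺ y -> nmem M x P /\ nmem M y P.
Proof.
  intros [H _]. destruct HP as [Hsub _].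
  destruct (Hsub _ H) as (a & Ha & b & Hb & E). apply pair_inj in E as [-> ->]. auto.
Qed.

Lemma prec_trans x y z : x ≺ y -> y ≺ z -> x ≺ z.
Proof.
  intros Hxy Hyz. destruct (lt_in_field _ _ Hxy), (lt_in_field _ _ Hyz).
  now apply (lt_in_trans P R HP) with y.
Qed.

Lemma prec_cross p0 q0 p1 q1 : p0 ≺ q0 -> p1 ≺ q1 ->
  p0 = q1 \/ p0 ≺ q1 \/ p1 = q0 \/ p1 ≺ q0.
Proof.
  intros H0 H1. destruct (lt_in_field _ _ H0) as [Hp0 Hq0].
  destruct (lt_in_field _ _ H1) as [Hp1 Hq1].
  destruct (Hfree p0 Hp0 q0 Hq0 p1 Hp1 q1 Hq1 (conj H0 H1)) as [H|H].
  - destruct (classic (p0 = q1)); [auto|right; left; now split].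
  - destruct (classic (p1 = q0)); [auto|right; right; right; now split].
Qed.

(** The point [pair s p] stands for the cut immediately to the right of the left
    endpoint of [p], as far as it is determined by the elements up to [s];
    [Y (pair (pair s p) z)] means that [z] lies entirely to the left of the cut.
    A later [z] is put there only if forced: some [b] with [z ≺ b] begins to the
    left of the cut, that is, every [w ≺ b] met so far lies to the left of it. *)
Definition cut_step n (Y : num M -> Prop) : Prop :=
  exists s, s < n + 1 /\ exists p, p < n + 1 /\
  exists x, x < n + 1 /\ exists z, z < n + 1 /\
  n = pair x z /\ x = pair s p /\
  ((z < s + 1 /\ z ≺ p) \/
   (s < z /\ exists b, b < z /\ z ≺ b /\
    forall w, w < z -> (w < b + 1 \/ w < s + 1) -> w ≺ b -> Y (pair x w))).

(** Course-of-values recursion applies: at the code of (x, z) only codes of (x, w) with w < z are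
    consulted. *)
Lemma cut_set_exists : exists X, forall n, nmem M n X <-> cut_step n (fun w => nmem M w X).
Proof.
  apply (recursion (fun _ => R)).
  - intros n Y Y' HY (s & Hs & p & Hp & x & Hx & z & Hz & En & Ex & H).
    exists s; split; [assumption|]. exists p; split; [assumption|].
    exists x; split; [assumption|]. exists z; split; [assumption|].
    split; [assumption|]. split; [assumption|].
    destruct H as [H|(Hsz & b & Hb & Hzb & H)]; [now left|right].
    split; [assumption|]. exists b. split; [assumption|]. split; [assumption|].
    intros w Hw Hwb Hprec. apply HY; [|now apply H].
    rewrite En. now apply pair_lt_r.
  - unfold cut_step, lt_in, rel_in, pair, in_code, modulus. definable.
Qed.

Section Cuts.
Variable X : set M.
Hypothesis HX : forall n, nmem M n X <-> cut_step n (fun w => nmem M w X).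

Local Notation left_of z x := (nmem M (pair x z) X).

Lemma left_of_iff s p z : left_of z (pair s p) <->
  (z < s + 1 /\ z ≺ p) \/
  (s < z /\ exists b, b < z /\ z ≺ b /\
   forall w, w < z -> (w < b + 1 \/ w < s + 1) -> w ≺ b -> left_of w (pair s p)).
Proof.
  rewrite HX. unfold cut_step. split.
  - intros (s' & _ & p' & _ & x & _ & z' & _ & E & -> & H).
    apply pair_inj in E as [E <-]. apply pair_inj in E as [<- <-]. exact H.
  - intros H.
    assert (Hx : forall v, v < pair s p + 1 -> v < pair (pair s p) z + 1).
    { intros v Hv. apply nle_trans with (1 := Hv), le_pair_l. }
    exists s; split; [apply Hx, le_pair_l|]. exists p; split; [apply Hx, le_pair_r|].
    exists (pair s p); split; [apply le_pair_l|]. exists z; split; [apply le_pair_r|].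
    auto.
Qed.

(** Predecessors of [b] beyond both [b] and the stage [s] are forced to the left, with [b] itself as
    the reason, so finitely many decisions settle them all. *)
Lemma below_left_of s p b :
  (forall w, w < b + 1 \/ w < s + 1 -> w ≺ b -> left_of w (pair s p)) ->
  forall w, w ≺ b -> left_of w (pair s p).
Proof.
  intros H w Hw.
  destruct (nlt_succ_or w b) as [Hb|Hb]; [auto|].
  destruct (nlt_succ_or w s) as [Hs|Hs]; [auto|].
  apply left_of_iff. right. split; [assumption|]. exists b.
  repeat (split; [assumption|]). auto.
Qed.

(** The witness is [p] for elements decided at the initial stage, where [p <= s] brings the
    predecessors to be checked into that stage; for a later [a] it is the element that forced [a] to
    the left. *)
Lemma left_of_witness s p a : p < s + 1 -> left_of a (pair s p) ->
  exists b, a ≺ b /\ forall w, w ≺ b -> left_of w (pair s p).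
Proof.
  intros Hps Ha. apply left_of_iff in Ha as [[Has Hap]|(Hsa & b & Hb & Hab & H)].
  - exists p. split; [assumption|]. apply below_left_of. intros w Hw Hwp.
    apply left_of_iff. left. split; [|assumption].
    destruct Hw as [Hw|Hw]; [now apply nle_trans with p|assumption].
  - exists b. split; [assumption|]. apply below_left_of. intros w Hw Hwb.
    apply H; [|assumption..]. destruct Hw as [Hw|Hw]; eapply nle_lt_trans; eassumption.
Qed.

(** The bounds on [s] and [p] make this definable by bounded quantifiers; the last conjunct places
    [p] inside the finite order of its stage. *)
Definition point x : Prop :=
  exists s, s < x + 1 /\ exists p, p < x + 1 /\ x = pair s p /\ nmem M p P /\ p < s + 1.

Lemma point_pair s p : nmem M p P -> p < s + 1 -> point (pair s p).
Proof.
  intros Hp Hps. exists s. split; [apply le_pair_l|]. exists p.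
  split; [apply le_pair_r|]. auto.
Qed.

Lemma point_witness x a : point x -> left_of a x ->
  exists b, a ≺ b /\ forall w, w ≺ b -> left_of w x.
Proof. intros (s & _ & p & _ & -> & _ & Hps). now apply left_of_witness. Qed.

Lemma left_of_down x a a' : point x -> left_of a x -> a' ≺ a -> left_of a' x.
Proof.
  intros Hx Ha Ha'. destruct (point_witness x a Hx Ha) as (b & Hab & Hb).
  apply Hb. now apply prec_trans with a.
Qed.

Definition cut_le x y : Prop := forall w, left_of w x -> left_of w y.

(** Without 2 + 2, sets of predecessors are comparable by inclusion, and this passes to unions of
    such sets. *)
Lemma cut_le_total x y : point x -> point y -> cut_le x y \/ cut_le y x.
Proof.
  intros Hx Hy. destruct (classic (cut_le x y)) as [H|H]; [now left|right].
  apply not_all_ex_not in H as [a Ha]. apply imply_to_and in Ha as [Hax Hay].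
  intros c Hcy.
  destruct (point_witness x a Hx Hax) as (b & Hab & Hb).
  destruct (point_witness y c Hy Hcy) as (b' & Hcb' & Hb').
  (* Each case either puts [c] to the left of [x] or contradicts that [a] is not to the left of
     [y]. *)
  destruct (prec_cross a b c b' Hab Hcb') as [->|[H|[->|H]]].
  - now apply left_of_down with b'.
  - exfalso. auto.
  - exfalso. apply Hay. now apply left_of_down with b.
  - auto.
Qed.

(* Beyond both stages the two cuts evolve by the same monotone rule. *)
Lemma cut_le_bounded x y : point x -> point y ->
  (forall w, w < x + y + 1 -> left_of w x -> left_of w y) -> cut_le x y.
Proof.
  intros (s & Hs & p & _ & Ex & _ & Hps) (t & Ht & q & _ & Ey & _ & Hqt) H.
  refine (strong_induct (fun _ => X) (fun w e =>
    nmem M (pair (e O) w) X -> nmem M (pair (e 1%nat) w) X) (env2 x y) _ _).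
  { unfold pair. definable. }
  cbn. intros w IH Hw.
  destruct (nlt_succ_or w s) as [Hws|Hws].
  { apply H; [|assumption]. apply nle_trans with (1 := Hws).
    apply nle_trans with (1 := Hs). apply nlt_succ_exists. now exists y. }
  destruct (nlt_succ_or w t) as [Hwt|Hwt].
  { apply H; [|assumption]. apply nle_trans with (1 := Hwt).
    apply nle_trans with (1 := Ht). apply nlt_succ_exists. exists x. ring. }
  subst x y. apply left_of_iff in Hw as [[Hw _]|(_ & b & Hb & Hwb & Hbelow)].
  { exfalso. apply (nlt_irrefl w). now apply nle_lt_trans with s. }
  apply left_of_iff. right. split; [assumption|]. exists b.
  repeat (split; [assumption|]). intros w' Hw' _ Hw'b. apply IH; [assumption|].
  revert w' Hw' Hw'b.
  (* The two stages impose different bounds, so the bound is removed first, by passing to all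
     predecessors of [b]. *)
  assert (Hcl : forall w', w' ≺ b -> left_of w' (pair s p)); [|auto].
  apply below_left_of. intros w' Hw' Hw'b. apply Hbelow; [|assumption..].
  destruct Hw' as [Hw'|Hw']; eapply nle_lt_trans; eassumption.
Qed.

Definition in_interval z x : Prop := ~ left_of z x /\ forall w, w ≺ z -> left_of w x.

(** Gives a bounded test for the points of F(z): the bounds [z] and [s] of [below_left_of] are both
    at most z + x. *)
Lemma in_interval_bounded z x : point x -> ~ left_of z x ->
  (forall w, w < z + x + 1 -> w ≺ z -> left_of w x) -> in_interval z x.
Proof.
  intros (s & Hs & p & _ & Ex & _ & _) Hz H. split; [assumption|]. subst x.
  apply below_left_of. intros w Hw Hwz. apply H; [|assumption].
  destruct Hw as [Hw|Hw]; apply nle_trans with (1 := Hw).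
  - apply nlt_succ_exists. now exists (pair s p).
  - apply nle_trans with (1 := Hs). apply nlt_succ_exists. exists z. ring.
Qed.

(** Up to [s] the cut is frozen as the set of predecessors of [p]; predecessors of [z] beyond [s]
    follow by [below_left_of]. *)
Lemma in_interval_stage s p z : p < s + 1 -> z < s + 1 -> ~ z ≺ p ->
  (forall w, w < s + 1 -> w ≺ z -> w ≺ p) -> in_interval z (pair s p).
Proof.
  intros Hp Hz Hzp H. split.
  - intros Hl. apply left_of_iff in Hl as [[_ Hl]|[Hl _]]; [contradiction|].
    apply (nlt_irrefl z). now apply nle_lt_trans with s.
  - apply below_left_of. intros w Hw Hwz.
    assert (Hws : w < s + 1).
    { destruct Hw as [Hw|Hw]; [now apply nle_trans with z|assumption]. }
    apply left_of_iff. left. auto.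
Qed.

(** At stage z + z' the left endpoint is taken from one of the two whose predecessors up to that
    stage include those of the other; both intervals reach it. *)
Lemma common_point z z' : nmem M z P -> nmem M z' P -> ~ z ≺ z' -> ~ z' ≺ z ->
  exists x, point x /\ in_interval z x /\ in_interval z' x.
Proof.
  intros Hz Hz' N N'.
  assert (Hs : z < z + z' + 1) by (apply nlt_succ_exists; now exists z').
  assert (Hs' : z' < z + z' + 1) by (apply nlt_succ_exists; exists z; ring).
  destruct (classic (forall w, w < z + z' + 1 -> w ≺ z' -> w ≺ z)) as [H|H].
  - exists (pair (z + z') z). split; [now apply point_pair|].
    split; apply in_interval_stage; auto. apply lt_in_irrefl.
  - exists (pair (z + z') z'). split; [now apply point_pair|].
    split; apply in_interval_stage; auto; [|apply lt_in_irrefl].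
    (* Some [w] precedes [z'] but not [z]; since 2 + 2 is omitted, every predecessor of [z] then
       precedes [z']. *)
    apply not_all_ex_not in H as [w H]. apply imply_to_and in H as [_ H].
    apply imply_to_and in H as [Hw Hwz]. intros v _ Hv.
    destruct (prec_cross w z' v z Hw Hv) as [->|[E|[->|E]]];
      [|contradiction| |assumption].
    + now apply prec_trans with z.
    + exfalso. apply Hwz. now apply prec_trans with z'.
Qed.

(** Cuts that never get separated are ordered by their codes. *)
Definition point_le x y : Prop := cut_le x y /\ (cut_le y x -> x < y + 1).

Lemma points_exist : exists L, forall x, nmem M x L <-> point x.
Proof.
  destruct (delta_comprehension M HM (fun _ => P) (fun e =>
    exists s, s < e O + 1 /\ exists p, p < e O + 1 /\
    e O = pair s p /\ nmem M p P /\ p < s + 1)) with (e := env1 0) as [L HL].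
  - unfold pair. definable.
  - now exists L.
Qed.

Variable L : set M.
Hypothesis HL : forall x, nmem M x L <-> point x.

(** Inclusion of cuts is replaced by its test below x + y + 1, which suffices by [cut_le_bounded];
    only bounded quantifiers remain. *)
Lemma point_le_exists : exists S, forall n, nmem M n S <->
  exists x, nmem M x L /\ exists y, nmem M y L /\ n = pair x y /\ point_le x y.
Proof.
  destruct (delta_comprehension M HM (scons L (fun _ => X)) (fun e =>
    exists x, x < e O + 1 /\ exists y, y < e O + 1 /\ e O = pair x y /\
    nmem M x L /\ nmem M y L /\
    (forall w, w < x + y + 1 -> left_of w x -> left_of w y) /\
    ((forall w, w < x + y + 1 -> left_of w y -> left_of w x) -> x < y + 1)))
    with (e := env1 0) as [S HS].
  - unfold pair. definable.
  - exists S. intros n. rewrite HS. cbn. split.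
    + intros (x & _ & y & _ & -> & Hx & Hy & Hle & Htie).
      exists x; split; [assumption|]. exists y; split; [assumption|].
      split; [reflexivity|]. split.
      * apply cut_le_bounded; auto; now apply HL.
      * intros H. apply Htie. auto.
    + intros (x & Hx & y & Hy & -> & Hle & Htie).
      exists x; split; [apply le_pair_l|]. exists y; split; [apply le_pair_r|].
      repeat (split; [auto; fail|]). intros H. apply Htie.
      apply cut_le_bounded; try now apply HL.
      now rewrite (nadd_comm y).
Qed.

Lemma intervals_exist : exists F, forall n, nmem M n F <->
  exists z, nmem M z P /\ exists x, nmem M x L /\ n = pair z x /\ in_interval z x.
Proof.
  destruct (delta_comprehension M HM (scons L (scons X (scons P (fun _ => R)))) (fun e =>
    exists z, z < e O + 1 /\ exists x, x < e O + 1 /\ e O = pair z x /\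
    nmem M z P /\ nmem M x L /\ ~ left_of z x /\
    forall w, w < z + x + 1 -> w ≺ z -> left_of w x))
    with (e := env1 0) as [F HF].
  - unfold lt_in, rel_in, pair. definable.
  - exists F. intros n. rewrite HF. cbn. split.
    + intros (z & _ & x & _ & -> & Hz & Hx & Hn & H).
      exists z; split; [assumption|]. exists x; split; [assumption|].
      split; [reflexivity|]. apply in_interval_bounded; auto; now apply HL.
    + intros (z & Hz & x & Hx & -> & Hn & H).
      exists z; split; [apply le_pair_l|]. exists x; split; [apply le_pair_r|]. auto 10.
Qed.
End Cuts.

Theorem no_two_plus_two_representation : exists L S F, sem_representation P R L S F.
Proof.
  destruct cut_set_exists as [X HX].
  destruct (points_exist) as [L HL].
  destruct (point_le_exists X HX L HL) as [S HS].
  destruct (intervals_exist X HX L HL) as [F HF].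
  assert (HS' : forall x y, rel_in S x y <->
    nmem M x L /\ nmem M y L /\ point_le X x y).
  { intros x y. unfold rel_in. rewrite HS. split.
    - intros (x' & Hx & y' & Hy & E & H). apply pair_inj in E as [-> ->]. auto.
    - intros (Hx & Hy & H). exists x; split; [assumption|]. exists y. auto. }
  assert (HF' : forall z x, rel_in F z x <->
    nmem M z P /\ nmem M x L /\ in_interval X z x).
  { intros z x. unfold rel_in. rewrite HF. split.
    - intros (z' & Hz & x' & Hx & E & H). apply pair_inj in E as [-> ->]. auto.
    - intros (Hz & Hx & H). exists z; split; [assumption|]. exists x. auto. }
  assert (Htot : forall x y, nmem M x L -> nmem M y L -> cut_le X x y \/ cut_le X y x).
  { intros x y Hx Hy. apply cut_le_total; [assumption|now apply HL..]. }
  assert (Hlin : sem_linear_order L S).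
  { split; [split; [|split; [|split]]|].
    - intros n Hn. apply HS in Hn as (x & Hx & y & Hy & -> & _).
      exists x; split; [assumption|]. now exists y.
    - intros x Hx. apply HS'. do 2 (split; [assumption|]).
      split; [now intros w|intros _; apply nle_refl].
    - intros x Hx y Hy z Hz [Hxy Hyz].
      apply HS' in Hxy as (_ & _ & Lxy & Txy). apply HS' in Hyz as (_ & _ & Lyz & Tyz).
      apply HS'. do 2 (split; [assumption|]). split; [intros w Hw; auto|].
      intros Lzx. apply nle_trans with y; [apply Txy|apply Tyz]; intros w Hw; auto.
    - intros x Hx y Hy [Hxy Hyx].
      apply HS' in Hxy as (_ & _ & Lxy & Txy). apply HS' in Hyx as (_ & _ & Lyx & Tyx).
      apply nle_antisym; auto.
    - intros x Hx y Hy. rewrite !HS'.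
      destruct (classic (cut_le X x y)) as [Lxy|Nxy];
        destruct (classic (cut_le X y x)) as [Lyx|Nyx].
      + destruct (nlt_succ_or x y) as [H|H].
        * left. do 2 (split; [assumption|]). now split.
        * right. do 2 (split; [assumption|]). split; [assumption|]. intros _.
          apply nlt_succ_r. now left.
      + left. do 2 (split; [assumption|]). split; [assumption|contradiction].
      + right. do 2 (split; [assumption|]). split; [assumption|contradiction].
      + exfalso. destruct (Htot x y Hx Hy); contradiction. }
  (* As a predecessor of [z'], [z] lies to the left of [y] but not of [x]; so the cut [y] is not
     included in [x], and [x] comes strictly first. *)
  assert (Hprec : forall z z' x y, z ≺ z' -> rel_in F z x -> rel_in F z' y -> lt_in S x y).
  { intros z z' x y Hzz' Hzx Hz'y. apply HF' in Hzx as (_ & Hx & Nzx & _).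
    apply HF' in Hz'y as (_ & Hy & _ & Hbelow).
    assert (Nyx : ~ cut_le X y x) by (intros H; apply Nzx, H, Hbelow, Hzz').
    split.
    - apply HS'. do 2 (split; [assumption|]).
      destruct (Htot x y Hx Hy) as [H|H]; [|contradiction]. split; [assumption|].
      intros H'. contradiction.
    - intros ->. apply Nyx. now intros w. }
  assert (Hne : forall z, nmem M z P -> exists x, nmem M x L /\ rel_in F z x).
  { intros z Hz.
    destruct (common_point X HX z z Hz Hz (lt_in_irrefl R z) (lt_in_irrefl R z))
      as (x & Hx & Hzx & _).
    apply HL in Hx. exists x. split; [assumption|]. now apply HF'. }
  exists L, S, F. split; [assumption|]. split; [|split].
  - intros n Hn. apply HF in Hn as (z & Hz & x & Hx & -> & _).
    exists z; split; [assumption|]. now exists x.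
  - intros z Hz. split; [now apply Hne|].
    intros x Hx y Hy v Hv (Hzx & Hzy & [Hxv _] & [Hvy _]).
    (* [x <= v] keeps the predecessors of [z] to the left of [v], and [v <= y] keeps [z] itself from
       being there. *)
    apply HF' in Hzx as (_ & _ & _ & Bx). apply HF' in Hzy as (_ & _ & Ny & _).
    apply HS' in Hxv as (_ & _ & Lxv & _). apply HS' in Hvy as (_ & _ & Lvy & _).
    apply HF'. repeat (split; [assumption|]). split; [auto|]. intros w Hw. apply Lxv; auto.
  - intros z Hz z' Hz'. split.
    + intros Hzz' x _ y _ [Hzx Hz'y]. now apply Hprec with z z'.
    + intros H. apply NNPP. intros N.
      (* If [z' ≺ z], nonempty intervals give points ordered both ways; otherwise, equality
         included, a common point would precede itself. *)
      destruct (classic (z' ≺ z)) as [Hz'z|N'].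
      * destruct (Hne z Hz) as (x & Hx & Hzx). destruct (Hne z' Hz') as (y & Hy & Hzy).
        destruct (H x Hx y Hy (conj Hzx Hzy)) as [Hxy Nxy]. apply Nxy.
        destruct Hlin as [(_ & _ & _ & Has) _]. apply Has; try assumption.
        split; [assumption|]. now apply (Hprec z' z y x).
      * destruct (common_point X HX z z' Hz Hz' N N') as (x & Hx & Hzx & Hz'x).
        apply HL in Hx. apply (lt_in_irrefl S x).
        apply (H x Hx x Hx). split; now apply HF'.
Qed.
End Representation.
End Arithmetic.

Theorem theorem1p1 :
  provable RCA0
    (fAllS (fAllS
       (partial_order 1 0 ⇒ (interval_order 1 0 <-> no_two_plus_two 1 0)))).
Proof.
  apply completeness. intros M HM e r P R.
  change (sem_partial_order M P R ->
    ((exists L S F, sem_representation M P R L S F) -> sem_no_two_plus_two M P R) /\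
    (sem_no_two_plus_two M P R -> exists L S F, sem_representation M P R L S F)).
  intros HP. split.
  - intros (L & S & F & H). exact (representation_no_two_plus_two M P R L S F HP H).
  (* The first [P] instantiates the auxiliary set [X0]. *)
  - exact (no_two_plus_two_representation M HM P P R HP).
Qed.
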